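(* For every finitely presented group $G$ there exist a finite simply connected simplicial complex $K$ and a finite set $V$ containing the set $K^0$ of vertices of $K$ such that the Alexander dual $K^*$ of $K$ with respect to $V$ has fundamental group isomorphic to $G$.
   Context: Finite simplicial complexes are abstract: a finite family of finite sets closed under taking subsets. The empty set is regarded as a simplex of every simplicial complex. $K^0$ is the set of vertices ($0$-simplices) of $K$. Given a finite set $V\supseteq K^0$, the Alexander dual of $K$ with respect to $V$ is $K^*=\{\sigma\subseteq V : V\smallsetminus\sigma\notin K\}$. Topological notions (simply connected, fundamental group) refer to the geometric realization. *)

(* Defs.v *)
From HB Require Import structures.
From mathcomp Require Import all_boot all_order all_algebra.
From mathcomp Require Import all_classical all_reals topology normedtype.
From mathcomp Require Import homotopy.
From mathcomp Require Import lra.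

Set Implicit Arguments.
Unset Strict Implicit.
Unset Printing Implicit Defensive.

Import Order.TTheory GRing.Theory Num.Theory numFieldNormedType.Exports.

(* A letter [(i, b)] is the [i]-th generator, inverted if [b = true]. *)
Definition word (n : nat) : Type := seq ('I_n * bool).

Definition inv_word n (w : word n) : word n :=
  rev [seq (l.1, ~~ l.2) | l <- w].

Section Eval.
Local Open Scope group_scope.

Definition eval_word (G : groupType) n (g : 'I_n -> G) (w : word n) : G :=
  \prod_(l <- w) (if l.2 then (g l.1)^-1 else g l.1).

End Eval.

(* Equality of words in the free group. *)
Inductive free_eq n : word n -> word n -> Prop :=
| free_eq_cancel u v i b : free_eq (u ++ (i, b) :: (i, ~~ b) :: v) (u ++ v)
| free_eq_refl u : free_eq u u
| free_eq_sym u v : free_eq u v -> free_eq v u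
| free_eq_trans u v w : free_eq u v -> free_eq v w -> free_eq u w.

(* The normal closure of [rels] in the free group, as a set of words saturated
   for [free_eq]. *)
Inductive normal_closure n (rels : seq (word n)) : word n -> Prop :=
| normal_closure_rel r : r \in rels -> normal_closure rels r
| normal_closure1 : normal_closure rels [::]
| normal_closureM u v :
    normal_closure rels u -> normal_closure rels v ->
    normal_closure rels (u ++ v)
| normal_closureV u : normal_closure rels u -> normal_closure rels (inv_word u)
| normal_closureJ u v :
    normal_closure rels u -> normal_closure rels (v ++ u ++ inv_word v)
| normal_closure_free u v :
    free_eq u v -> normal_closure rels u -> normal_closure rels v.

(* [g] induces an epimorphism from the free group of rank [n] onto [G], with
   kernel the normal closure of [rels]. *)
Definition is_presentation (G : groupType) n (g : 'I_n -> G)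
    (rels : seq (word n)) : Prop :=
  (forall x : G, exists w, eval_word g w = x) /\
  (forall w, eval_word g w = 1%g <-> normal_closure rels w).

Definition finitely_presented (G : groupType) : Prop :=
  exists (n : nat) (g : 'I_n -> G) (rels : seq (word n)),
    is_presentation g rels.

Definition group_isomorphic (G H : groupType) : Prop :=
  exists f : {multiplicative G -> H}, bijective f.

Local Open Scope classical_set_scope.
Local Open Scope ring_scope.

Definition unit_interval (R : realType) : Type := set_type `[0%R, 1%R : R].

Section UnitInterval.
Context {R : realType}.
Local Notation I := (unit_interval R).

HB.instance Definition _ :=
  Topological.copy I (set_type `[0%R, 1%R : R]).

Definition uval (t : I) : R := set_val t.

Lemma uval_itv (t : I) : 0 <= uval t <= 1.
Proof.
by case: t => t /= h; rewrite /uval set_valE /=; move/set_mem: h; rewrite /= in_itv.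
Qed.

Fact clamp_subproof (r : R) : Num.min 1 (Num.max 0 r) \in `[0, 1 : R]%classic.
Proof.
apply/mem_set; rewrite /= in_itv /= le_min ler01 le_max lexx /=.
by rewrite ge_min lexx.
Qed.

Definition clamp (r : R) : I :=
  exist (fun t => t \in `[0, 1 : R]%classic) _ (clamp_subproof r).

Lemma uval_clampE r : uval (clamp r) = Num.min 1 (Num.max 0 r).
Proof. by []. Qed.

Lemma uval_clamp r : 0 <= r <= 1 -> uval (clamp r) = r.
Proof.
by move=> /andP[r0 r1]; rewrite uval_clampE (max_idPr r0) (min_idPr r1).
Qed.

Lemma uval_inj : injective uval.
Proof. by move=> [s hs] [t ht]; rewrite /uval !set_valE /= => st; apply: eq_exist. Qed.

Lemma uvalK (t : I) : clamp (uval t) = t.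
Proof. by apply: uval_inj; rewrite uval_clamp ?uval_itv. Qed.

Lemma clamp_le0 r : r <= 0 -> clamp r = clamp 0.
Proof.
by move=> r0; apply: uval_inj; rewrite !uval_clampE (max_idPl r0) maxxx.
Qed.

Lemma clamp_ge1 r : 1 <= r -> clamp r = clamp 1.
Proof.
move=> r1; apply: uval_inj; rewrite !uval_clampE (max_idPr ler01) minxx.
by apply/min_idPl; rewrite le_max r1 orbT.
Qed.

Fact clamp01 : clamp 0 != clamp 1.
Proof.
apply/eqP => /(congr1 uval); rewrite !uval_clamp ?lexx ?ler01//.
by apply/eqP; rewrite eq_sym oner_eq0.
Qed.

HB.instance Definition _ := isBiPointed.Build I clamp01.

End UnitInterval.
Section UnitIntervalTheory.
Context {R : realType}.
Local Notation I := (unit_interval R).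

Lemma uval_continuous : continuous (@uval R).
Proof. exact: initial_continuous. Qed.

Lemma clamp_continuous : continuous (@clamp R).
Proof.
apply: continuous_comp_initial => r.
apply: (@continuous_min _ _ (fun=> 1)); first exact: cvg_cst.
by apply: continuous_max; [exact: cvg_cst|exact: cvg_id].
Qed.

Lemma uval0 : uval (zero : I) = 0.
Proof. by rewrite uval_clamp// lexx ler01. Qed.

Lemma uval1 : uval (one : I) = 1.
Proof. by rewrite uval_clamp// lexx ler01. Qed.

Lemma glue_continuous (Y X : topologicalType) (f g : Y -> X) (h : Y -> R)
    (a : R) :
  continuous f -> continuous g -> continuous h ->
  (forall y, h y = a -> f y = g y) ->
  continuous (fun y => if h y <= a then f y else g y).
Proof.
move=> cf cg ch fg.
have AB : h @^-1` [set r | r <= a] `|` h @^-1` [set r | a <= r] = setT.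
  by rewrite -subTset => y _; case: (leP (h y) a) => [|/ltW]; [left|right].
apply/continuous_subspace_setT; rewrite -AB; apply: withinU_continuous.
- by apply: closed_comp => // y _; exact: ch.
- by apply: closed_comp => // y _; exact: ch.
- apply: (@subspace_eq_continuous _ _ _ f); last exact: continuous_subspaceT.
  by move=> y; rewrite inE /= => hy; rewrite /from_subspace hy.
- apply: (@subspace_eq_continuous _ _ _ g); last exact: continuous_subspaceT.
  move=> y; rewrite inE /= => hy; rewrite /from_subspace; case: ifPn => // hy'.
  by rewrite fg//; apply/eqP; rewrite eq_le hy hy'.
Qed.

Lemma continuous_compose (X Y Z : topologicalType) (f : X -> Y) (g : Y -> Z) :
  continuous f -> continuous g -> continuous (g \o f).
Proof. by move=> cf cg x; apply: continuous_comp; [exact: cf|exact: cg]. Qed.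

Lemma continuous_pair (X Y Z : topologicalType) (f : X -> Y) (g : X -> Z) :
  continuous f -> continuous g -> continuous (fun x => (f x, g x)).
Proof. by move=> cf cg x; apply: cvg_pair; [exact: cf|exact: cg]. Qed.

Lemma continuous_affine (Y : topologicalType) (h : Y -> R) (a b : R) :
  continuous h -> continuous (fun y => a * h y + b).
Proof.
move=> ch y; apply: (@continuousD _ _ _ (fun y => a * h y) (fun=> b)).
  by apply: continuousM; [exact: cvg_cst|exact: ch].
exact: cvg_cst.
Qed.

Lemma continuous_minr (Y : topologicalType) (f g : Y -> R) :
  continuous f -> continuous g -> continuous (fun y => Num.min (f y) (g y)).
Proof.
by move=> cf cg y; apply: (@continuous_min _ _ f g); [exact: cf|exact: cg].
Qed.

Lemma continuous_maxr (Y : topologicalType) (f g : Y -> R) :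
  continuous f -> continuous g -> continuous (fun y => Num.max (f y) (g y)).
Proof.
by move=> cf cg y; apply: (@continuous_max _ _ f g); [exact: cf|exact: cg].
Qed.

Lemma continuous_affine_id (a b : R) : continuous (fun r => a * r + b).
Proof. by apply: continuous_affine => r; exact: cvg_id. Qed.

End UnitIntervalTheory.

Section Paths.
Context {R : realType} {X : topologicalType}.
Local Notation I := (unit_interval R).

Local Notation "{ 'path' x ~> y }" := {path I from x to y in X}
  (at level 0, x at level 69, y at level 69).

(* Homotopy relative to the endpoints. *)
Definition path_homotopic (x y : X) (p q : {path x ~> y}) : Prop :=
  exists H : I * I -> X,
    [/\ continuous H,
        forall t, H (t, zero) = p t,
        forall t, H (t, one) = q t &
        forall s, H (zero, s) = x /\ H (one, s) = y].

Definition path_ext (x y : X) (p : {path x ~> y}) (r : R) : X := p (clamp r).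

Lemma path_ext_continuous x y (p : {path x ~> y}) : continuous (path_ext p).
Proof. exact: continuous_compose clamp_continuous (@cts_fun _ _ p). Qed.

Lemma path_ext_le0 x y (p : {path x ~> y}) r : r <= 0 -> path_ext p r = x.
Proof. by move=> r0; rewrite /path_ext clamp_le0// path_zero. Qed.

Lemma path_ext_ge1 x y (p : {path x ~> y}) r : 1 <= r -> path_ext p r = y.
Proof. by move=> r1; rewrite /path_ext clamp_ge1// path_one. Qed.

Lemma path_extE x y (p : {path x ~> y}) t : p t = path_ext p (uval t).
Proof. by rewrite /path_ext uvalK. Qed.

Section Concatenation.
Context {x y z : X} (p : {path x ~> y}) (q : {path y ~> z}).

Definition cat_fun (t : I) : X :=
  if uval t <= 2^-1 then p (clamp (2 * uval t))
  else q (clamp (2 * uval t - 1)).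

Fact cat_fun_continuous : continuous cat_fun.
Proof.
apply: glue_continuous.
- apply: (@continuous_compose _ _ _ (fun t => 2 * uval t) (path_ext p)).
    have := @continuous_affine R _ _ 2 0 (@uval_continuous R).
    by under eq_fun do rewrite addr0.
  exact: path_ext_continuous.
- apply: (@continuous_compose _ _ _ (fun t => 2 * uval t - 1) (path_ext q)).
    exact: continuous_affine (@uval_continuous R).
  exact: path_ext_continuous.
- exact: uval_continuous.
- move=> t ->; rewrite -/(path_ext _ _) -/(path_ext _ _).
  by rewrite path_ext_ge1 ?path_ext_le0//; lra.
Qed.

Fact cat_fun_zero : cat_fun zero = x.
Proof.
rewrite /cat_fun uval0 ifT; last by lra.
by rewrite -/(path_ext _ _) path_ext_le0//; lra.
Qed.

Fact cat_fun_one : cat_fun one = z.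
Proof.
rewrite /cat_fun uval1 ifF; last by apply/negbTE; rewrite -ltNge; lra.
by rewrite -/(path_ext _ _) path_ext_ge1//; lra.
Qed.

(* [p] on [[0, 1/2]] followed by [q] on [[1/2, 1]], both at double speed. *)
Definition cat_path : {path x ~> z} :=
  mk_path cat_fun_continuous cat_fun_zero cat_fun_one.

Lemma cat_path_ext r :
  path_ext cat_path r =
  if r <= 2^-1 then path_ext p (2 * r) else path_ext q (2 * r - 1).
Proof.
have -> : path_ext cat_path r =
    if uval (clamp r) <= 2^-1 then path_ext p (2 * uval (clamp r))
    else path_ext q (2 * uval (clamp r) - 1) by [].
have [r0|r0] := leP r 0.
  rewrite clamp_le0// -[clamp 0]/zero uval0 !ifT; [|lra..].
  by rewrite !path_ext_le0//; lra.
have [r1|r1] := leP 1 r.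
  rewrite clamp_ge1// -[clamp 1]/one uval1 !ifF; [|by apply/negbTE; rewrite -ltNge; lra..].
  by rewrite !path_ext_ge1//; lra.
by rewrite uval_clamp//; lra.
Qed.

End Concatenation.

Section Reverse.
Context {x y : X} (p : {path x ~> y}).

Definition rev_fun (t : I) : X := p (clamp (1 - uval t)).

Fact rev_fun_continuous : continuous rev_fun.
Proof.
apply: (@continuous_compose _ _ _ (fun t => 1 - uval t) (path_ext p)).
  have := @continuous_affine R _ _ (-1) 1 (@uval_continuous R).
  by under eq_fun do rewrite mulN1r addrC.
exact: path_ext_continuous.
Qed.

Fact rev_fun_zero : rev_fun zero = y.
Proof. by rewrite /rev_fun uval0 -/(path_ext _ _) path_ext_ge1//; lra. Qed.

Fact rev_fun_one : rev_fun one = x.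
Proof. by rewrite /rev_fun uval1 -/(path_ext _ _) path_ext_le0//; lra. Qed.

Definition rev_path : {path y ~> x} :=
  mk_path rev_fun_continuous rev_fun_zero rev_fun_one.

Lemma rev_path_ext r : path_ext rev_path r = path_ext p (1 - r).
Proof.
have -> : path_ext rev_path r = path_ext p (1 - uval (clamp r)) by [].
have [r0|r0] := leP r 0.
  by rewrite clamp_le0// -[clamp 0]/zero uval0 !path_ext_ge1//; lra.
have [r1|r1] := leP 1 r.
  by rewrite clamp_ge1// -[clamp 1]/one uval1 !path_ext_le0//; lra.
by rewrite uval_clamp//; lra.
Qed.

End Reverse.

Definition cst_path (x : X) : {path x ~> x} := cst x.

Lemma path_homotopic_refl x y (p : {path x ~> y}) : path_homotopic p p.
Proof.
exists (p \o fst); split => //=; last by rewrite path_zero path_one.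
apply: continuous_compose; last exact: cts_fun.
by move=> ?; exact: cvg_fst.
Qed.

Let fst_cts : continuous (fun ts : I * I => ts.1).
Proof. by move=> ?; exact: cvg_fst. Qed.

Let snd_cts : continuous (fun ts : I * I => ts.2).
Proof. by move=> ?; exact: cvg_snd. Qed.

Let ufst_cts : continuous (fun ts : I * I => uval ts.1).
Proof. exact: continuous_compose fst_cts (@uval_continuous R). Qed.

Let usnd_cts : continuous (fun ts : I * I => uval ts.2).
Proof. exact: continuous_compose snd_cts (@uval_continuous R). Qed.

Let clamp_affine_cts (h : I * I -> R) (a b : R) :
  continuous h -> continuous (fun ts => clamp (a * h ts + b)).
Proof.
move=> ch; apply: (@continuous_compose _ _ _ _ (@clamp R)).
  exact: continuous_affine.
exact: clamp_continuous.
Qed.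

Lemma path_homotopic_sym x y (p q : {path x ~> y}) :
  path_homotopic p q -> path_homotopic q p.
Proof.
move=> [H [cH H0 H1 He]].
exists (fun ts => H (ts.1, clamp (-1 * uval ts.2 + 1))); split => /=.
- apply: (@continuous_compose _ _ _ _ H) => //.
  by apply: continuous_pair => //; exact: clamp_affine_cts.
- by move=> t; rewrite uval0 mulr0 add0r -[clamp 1]/one H1.
- by move=> t; rewrite uval1 mulr1 addNr -[clamp 0]/zero H0.
- by move=> s; exact: He.
Qed.

Lemma path_homotopic_trans x y (q p r : {path x ~> y}) :
  path_homotopic p q -> path_homotopic q r -> path_homotopic p r.
Proof.
move=> [H [cH H0 H1 He]] [K [cK K0 K1 Ke]].
exists (fun ts => if uval ts.2 <= 2^-1 then H (ts.1, clamp (2 * uval ts.2 + 0))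
                  else K (ts.1, clamp (2 * uval ts.2 - 1))); split => /=.
- apply: glue_continuous => //.
  + apply: (@continuous_compose _ _ _ _ H) => //.
    by apply: continuous_pair => //; exact: clamp_affine_cts.
  + apply: (@continuous_compose _ _ _ _ K) => //.
    by apply: continuous_pair => //; exact: clamp_affine_cts.
  + move=> [t s] /= ->; rewrite addr0 mulfV ?pnatr_eq0// subrr.
    by rewrite H1 K0.
- move=> t; rewrite uval0 ifT; last by lra.
  by rewrite mulr0 addr0 H0.
- move=> t; rewrite uval1 ifF; last by apply/negbTE; rewrite -ltNge; lra.
  by rewrite clamp_ge1 ?K1//; lra.
- by move=> s; case: ifP => _; [exact: He|exact: Ke].
Qed.

Lemma path_homotopic_cat x y z (p p' : {path x ~> y}) (q q' : {path y ~> z}) :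
  path_homotopic p p' -> path_homotopic q q' ->
  path_homotopic (cat_path p q) (cat_path p' q').
Proof.
move=> [H [cH H0 H1 He]] [K [cK K0 K1 Ke]].
exists (fun ts => if uval ts.1 <= 2^-1 then H (clamp (2 * uval ts.1 + 0), ts.2)
                  else K (clamp (2 * uval ts.1 - 1), ts.2)); split => /=.
- apply: glue_continuous => //.
  + apply: (@continuous_compose _ _ _ _ H) => //.
    by apply: continuous_pair => //; exact: clamp_affine_cts.
  + apply: (@continuous_compose _ _ _ _ K) => //.
    by apply: continuous_pair => //; exact: clamp_affine_cts.
  + move=> [t s] /= ->; rewrite addr0 mulfV ?pnatr_eq0// subrr.
    by rewrite (He s).2 (Ke s).1.
- by move=> t; rewrite addr0 H0 K0.
- by move=> t; rewrite addr0 H1 K1.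
- move=> s; rewrite uval0 uval1 ifT; last by lra.
  rewrite ifF; last by apply/negbTE; rewrite -ltNge; lra.
  rewrite mulr0 addr0 (@clamp_ge1 _ (2 * 1 - 1)); last by lra.
  by rewrite (He s).1 (Ke s).2.
Qed.

Lemma path_homotopic_rev x y (p q : {path x ~> y}) :
  path_homotopic p q -> path_homotopic (rev_path p) (rev_path q).
Proof.
move=> [H [cH H0 H1 He]].
exists (fun ts => H (clamp (-1 * uval ts.1 + 1), ts.2)); split => /=.
- apply: (@continuous_compose _ _ _ _ H) => //.
  by apply: continuous_pair => //; exact: clamp_affine_cts.
- by move=> t; rewrite H0 mulN1r addrC.
- by move=> t; rewrite H1 mulN1r addrC.
- move=> s; rewrite uval0 uval1 mulr0 add0r mulr1 addNr.
  by rewrite (He s).1 (He s).2.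
Qed.

(* Two reparametrizations of a path with the same endpoints are homotopic, by
   the straight-line homotopy between the parameters. *)
Lemma path_homotopic_reparam u v x y (g : {path u ~> v}) (p q : {path x ~> y})
    (phi psi : R -> R) :
  continuous phi -> continuous psi -> phi 0 = psi 0 -> phi 1 = psi 1 ->
  (forall r, 0 <= r <= 1 -> path_ext p r = path_ext g (phi r)) ->
  (forall r, 0 <= r <= 1 -> path_ext q r = path_ext g (psi r)) ->
  path_homotopic p q.
Proof.
move=> cphi cpsi h0 h1 pE qE.
exists (fun ts => path_ext g (phi (uval ts.1) +
                   uval ts.2 * (psi (uval ts.1) - phi (uval ts.1)))); split => /=.
- apply: (@continuous_compose _ _ _ _ (path_ext g)).
    have c1 := continuous_compose ufst_cts cphi.
    have c2 := continuous_compose ufst_cts cpsi.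
    move=> ts; apply: (@continuousD _ _ _ (fun ts => phi (uval ts.1))
      (fun ts => uval ts.2 * (psi (uval ts.1) - phi (uval ts.1)))).
      exact: c1.
    apply: (@continuousM _ _ (fun ts => uval ts.2)
      (fun ts => psi (uval ts.1) - phi (uval ts.1))); first exact: usnd_cts.
    apply: (@continuousB _ _ _ (fun ts => psi (uval ts.1))
      (fun ts => phi (uval ts.1))); first exact: c2.
    exact: c1.
  exact: path_ext_continuous.
- by move=> t; rewrite uval0 mul0r addr0 -pE ?uval_itv// path_extE.
- by move=> t; rewrite uval1 mul1r addrC subrK -qE ?uval_itv// path_extE.
- move=> s; rewrite uval0 uval1 h0 h1 !subrr !mulr0 !addr0.
  rewrite -!qE ?lexx ?ler01//.
  by rewrite path_ext_le0// path_ext_ge1.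
Qed.

Let id_cts : continuous (id : R -> R). Proof. by move=> ?; exact: cvg_id. Qed.

Local Ltac min_lra :=
  repeat match goal with
  | |- context [Num.min ?a ?b] =>
      lazymatch b with Num.min _ _ => fail | _ => case: (leP a b) => ? end
  end; lra.

Lemma path_homotopic_catA w x y z (p : {path w ~> x}) (q : {path x ~> y})
    (r : {path y ~> z}) :
  path_homotopic (cat_path p (cat_path q r)) (cat_path (cat_path p q) r).
Proof.
pose phi t : R := Num.min (2 * t + 0) (Num.min (1 * t + 4^-1) (2^-1 * t + 2^-1)).
apply: (@path_homotopic_reparam _ _ _ _ (cat_path p (cat_path q r)) _ _ id phi).
- exact: id_cts.
- apply: continuous_minr; first exact: continuous_affine_id.
  by apply: continuous_minr; exact: continuous_affine_id.
- by rewrite /phi; min_lra.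
- by rewrite /phi; min_lra.
- by [].
- move=> t /andP[t0 t1]; rewrite !cat_path_ext.
  have [h1|h1] := leP t 4^-1.
    have -> : phi t = 2 * t by rewrite /phi; min_lra.
    rewrite !ifT; [by []|lra..].
  have [h2|h2] := leP t 2^-1.
    have -> : phi t = t + 4^-1 by rewrite /phi; min_lra.
    have -> : (2 * t <= 2^-1) = false by lra.
    have -> : (t + 4^-1 <= 2^-1) = false by lra.
    rewrite ifT; last by lra.
    by congr path_ext; lra.
  have -> : phi t = 2^-1 * t + 2^-1 by rewrite /phi; min_lra.
  have -> : (2^-1 * t + 2^-1 <= 2^-1) = false by lra.
  have -> : (2 * (2^-1 * t + 2^-1) - 1 <= 2^-1) = false by lra.
  by congr path_ext; lra.
Qed.

Lemma path_ext_cst x r : path_ext (cst_path x) r = x.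
Proof. by []. Qed.

Lemma path_homotopic_cat1p x y (p : {path x ~> y}) :
  path_homotopic (cat_path (cst_path x) p) p.
Proof.
apply: (@path_homotopic_reparam _ _ _ _ p _ _
  (fun t => Num.max 0 (2 * t - 1)) id) => //.
- apply: continuous_maxr; first by move=> t; exact: cvg_cst.
  exact: continuous_affine_id.
- by rewrite maxEle; case: ifP; lra.
- by rewrite maxEle; case: ifP; lra.
- move=> t t01; rewrite cat_path_ext path_ext_cst maxEle.
  case: (leP t 2^-1) => h; last by congr path_ext; case: ifP; lra.
  by rewrite path_ext_le0//; case: ifP; lra.
Qed.

Lemma path_homotopic_catp1 x y (p : {path x ~> y}) :
  path_homotopic (cat_path p (cst_path y)) p.
Proof.
apply: (@path_homotopic_reparam _ _ _ _ p _ _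
  (fun t => Num.min 1 (2 * t + 0)) id) => //.
- apply: continuous_minr; first by move=> t; exact: cvg_cst.
  exact: continuous_affine_id.
- by rewrite minEle; case: ifP; lra.
- by rewrite minEle; case: ifP; lra.
- move=> t t01; rewrite cat_path_ext path_ext_cst minEle addr0.
  case: (leP t 2^-1) => h; last by rewrite path_ext_ge1//; case: ifP; lra.
  by congr path_ext; case: ifP; lra.
Qed.

Lemma path_homotopic_catpV x y (p : {path x ~> y}) :
  path_homotopic (cat_path p (rev_path p)) (cst_path x).
Proof.
apply: (@path_homotopic_reparam _ _ _ _ p _ _
  (fun t => Num.min (2 * t + 0) (-2 * t + 2)) (fun=> 0)).
- by apply: continuous_minr; exact: continuous_affine_id.
- by move=> t; exact: cvg_cst.
- by rewrite minEle; case: ifP; lra.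
- by rewrite minEle; case: ifP; lra.
- move=> t t01; rewrite cat_path_ext rev_path_ext minEle.
  by case: (leP t 2^-1) => h; congr path_ext; case: ifP; lra.
- by move=> t t01; rewrite path_ext_cst path_ext_le0.
Qed.

Lemma path_homotopic_catVp x y (p : {path x ~> y}) :
  path_homotopic (cat_path (rev_path p) p) (cst_path y).
Proof.
apply: (@path_homotopic_reparam _ _ _ _ p _ _
  (fun t => Num.max (-2 * t + 1) (2 * t - 1)) (fun=> 1)).
- by apply: continuous_maxr; exact: continuous_affine_id.
- by move=> t; exact: cvg_cst.
- by rewrite maxEle; case: ifP; lra.
- by rewrite maxEle; case: ifP; lra.
- move=> t t01; rewrite cat_path_ext rev_path_ext maxEle.
  by case: (leP t 2^-1) => h; congr path_ext; case: ifP; lra.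
- by move=> t t01; rewrite path_ext_cst path_ext_ge1.
Qed.

End Paths.

Section FundamentalGroup.
Context (R : realType) (X : topologicalType) (x : X).
Local Notation loop := {path unit_interval R from x to x in X}.
Local Open Scope quotient_scope.

Definition loop_homotopic (p q : loop) : bool := `[< path_homotopic p q >].

Fact loop_homotopic_refl : reflexive loop_homotopic.
Proof. by move=> p; apply/asboolP; exact: path_homotopic_refl. Qed.

Fact loop_homotopic_sym : symmetric loop_homotopic.
Proof.
by move=> p q; apply/asboolP/asboolP; exact: path_homotopic_sym.
Qed.

Fact loop_homotopic_trans : transitive loop_homotopic.
Proof.
move=> q p r /asboolP pq /asboolP qr; apply/asboolP.
exact: path_homotopic_trans pq qr.
Qed.

Canonical loop_homotopic_equiv := EquivRel loop_homotopic
  loop_homotopic_refl loop_homotopic_sym loop_homotopic_trans.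

Definition fundamental_group : Type := {eq_quot loop_homotopic}.

HB.instance Definition _ := Choice.on fundamental_group.
HB.instance Definition _ := EqQuotient.on fundamental_group.

Definition loop_class (p : loop) : fundamental_group :=
  \pi_fundamental_group p.

Lemma loop_classP (p q : loop) :
  loop_class p = loop_class q <-> path_homotopic p q.
Proof.
split=> [/eqP|pq].
  by rewrite /loop_class eqmodE => /asboolP.
by apply/eqP; rewrite /loop_class eqmodE; apply/asboolP.
Qed.

Lemma loop_class_repr (g : fundamental_group) : loop_class (repr g) = g.
Proof. exact: reprK. Qed.

Lemma loop_class_surj (g : fundamental_group) : exists p, g = loop_class p.
Proof. by exists (repr g); rewrite loop_class_repr. Qed.

Definition pi1_one : fundamental_group := loop_class (cst_path x).
Definition pi1_mul (g h : fundamental_group) : fundamental_group :=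
  loop_class (cat_path (repr g) (repr h)).
Definition pi1_inv (g : fundamental_group) : fundamental_group :=
  loop_class (rev_path (repr g)).

Fact pi1_mulE p q :
  pi1_mul (loop_class p) (loop_class q) = loop_class (cat_path p q).
Proof.
by apply/loop_classP/path_homotopic_cat; apply/loop_classP/loop_class_repr.
Qed.

Fact pi1_invE p : pi1_inv (loop_class p) = loop_class (rev_path p).
Proof. by apply/loop_classP/path_homotopic_rev/loop_classP/loop_class_repr. Qed.

Fact pi1_mulA : associative pi1_mul.
Proof.
move=> f g h; have [p ->] := loop_class_surj f.
have [q ->] := loop_class_surj g; have [r ->] := loop_class_surj h.
by rewrite !pi1_mulE; apply/loop_classP; exact: path_homotopic_catA.
Qed.

Fact pi1_mul1g : left_id pi1_one pi1_mul.
Proof.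
move=> g; have [p ->] := loop_class_surj g.
by rewrite pi1_mulE; apply/loop_classP; exact: path_homotopic_cat1p.
Qed.

Fact pi1_mulg1 : right_id pi1_one pi1_mul.
Proof.
move=> g; have [p ->] := loop_class_surj g.
by rewrite pi1_mulE; apply/loop_classP; exact: path_homotopic_catp1.
Qed.

Fact pi1_mulVg : left_inverse pi1_one pi1_inv pi1_mul.
Proof.
move=> g; have [p ->] := loop_class_surj g.
by rewrite pi1_invE pi1_mulE; apply/loop_classP; exact: path_homotopic_catVp.
Qed.

Fact pi1_mulgV : right_inverse pi1_one pi1_inv pi1_mul.
Proof.
move=> g; have [p ->] := loop_class_surj g.
by rewrite pi1_invE pi1_mulE; apply/loop_classP; exact: path_homotopic_catpV.
Qed.

HB.instance Definition _ := isGroup.Build fundamental_group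
  pi1_mulA pi1_mul1g pi1_mulg1 pi1_mulVg pi1_mulgV.

End FundamentalGroup.

Definition path_connected (R : realType) (X : topologicalType) : Prop :=
  inhabited X /\
  forall x y : X, inhabited {path unit_interval R from x to y in X}.

Definition simply_connected (R : realType) (X : topologicalType) : Prop :=
  path_connected R X /\ forall (x : X) (g : fundamental_group R x), g = 1%g.

(* The isomorphism type of the fundamental group is a property of the space
   only for path-connected ones. *)
Definition has_fundamental_group (R : realType) (X : topologicalType)
    (G : groupType) : Prop :=
  path_connected R X /\
  forall x : X, group_isomorphic (fundamental_group R x) G.

Local Close Scope classical_set_scope.

Section SimplicialComplex.
Variable T : finType.
Implicit Types (K : {set {set T}}) (V : {set T}).

Definition simplicial_complex K : Prop :=
  finset.set0 \in K /\ forall s t : {set T}, s \in K -> t \subset s -> t \in K.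

Definition vertices K : {set T} := [set v : T | [set v] \in K].

Definition alexander_dual V K : {set {set T}} :=
  [set s : {set T} | (s \subset V) && (V :\: s \notin K)].

(* If [V \in K], e.g. if [K] is the full simplex on [V], the dual is the empty
   family, and its realization is empty. *)
Lemma alexander_dual_complex V K :
  simplicial_complex K -> V \notin K -> simplicial_complex (alexander_dual V K).
Proof.
move=> [K0 Kd] VK; split=> [|s t]; rewrite !inE ?finset.sub0set ?finset.setD0//.
move=> /andP[sV sK] ts; rewrite (fintype.subset_trans ts sV) /=.
apply: contra sK => tK; apply: Kd tK _; exact: finset.setDS.
Qed.

(* Barycentric coordinates; [T] being finite, the product topology induces the
   usual topology on the realization. *)
Definition realization_set (R : realType) K : set {ptws T -> R} :=
  [set x : {ptws T -> R} | [/\ forall v, 0 <= x v, \sum_v x v = 1 &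
    [set v : T | x v != 0]%SET \in K]]%classic.

Definition realization (R : realType) K : topologicalType :=
  set_type (@realization_set R K).

End SimplicialComplex.

Arguments realization {T} R K.

(* Main.v *)
Require Import Defs.
From HB Require Import structures.
From mathcomp Require Import all_boot all_order all_algebra.
From mathcomp Require Import all_classical all_reals topology normedtype.
From mathcomp Require Import homotopy.
From mathcomp Require Import lra interval_inference.

(* If every face of a complex L on V omits at least four elements of V, its dual
   contains every subset of V with at most three elements, so it is simply
   connected, and the dual of the dual is L. So it is enough to realize G as the
   fundamental group of some finite complex L and to add four idle elements
   to V.

   For L, take a finite vertex set with a base point and a G-valued labelling of
   the ordered pairs of vertices; the simplices are the sets on which the
   labelling is a coboundary. A relator r gives a full simplex labelled by
   the prefixes of r, a generator gives an edge, and each letter of r is tied to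
   the edge of its generator. Pairs labelled 1 form a triangle with the base
   point, so those without a purpose do no harm.

   If every vertex of a complex is joined to b, the fundamental group at b is the universal
   group of the cocycles on the edges that are trivial on the edges from b:
   a cocycle has a holonomy along any path, computed by cutting the path into
   pieces each lying in an open star. Holonomy for the labelling maps
   the fundamental group to G; holonomy for the tautological cocycle, which
   sends an edge to the class of the triangle over it, is the identity, so these
   classes generate. For L both groups then have the same presentation. *)

Set Implicit Arguments.
Unset Strict Implicit.
Unset Printing Implicit Defensive.

Import Order.TTheory GRing.Theory Num.Theory numFieldNormedType.Exports.

Local Notation cat_path := Defs.cat_path.
Local Notation rev_path := Defs.rev_path.

(** * Holonomy of a group-valued cocycle along a family of vertex sets *)

Section Holonomy.
Context {R : realType} {T : finType} {G : groupType}.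
Variable g : T -> T -> G.
Local Open Scope ring_scope.
Local Open Scope group_scope.
Implicit Types (f : R -> {set T}) (a b c t : R) (u v w : T) (x y : G).

(** In the applications [f t] is the carrier of the point at time [t], so [v \in f t] says that the
    point lies in the open star of [v]. This is a relation because the product depends a priori on
    the chosen subdivision. *)
Inductive holonomy f : R -> R -> T -> T -> G -> Prop :=
| holonomy_star a c u v w : a <= c -> u \in f a -> w \in f c ->
    (forall t, a <= t <= c -> v \in f t) ->
    holonomy f a c u w (g u v * g v w)
| holonomy_cat a b c u v w x y :
    holonomy f a b u v x -> holonomy f b c v w y ->
    holonomy f a c u w (x * y).

Definition cocycle_on (s : {set T}) : Prop :=
  forall u v w, u \in s -> v \in s -> w \in s -> g u v * g v w = g u w.

Lemma cocycle_on_refl s u : cocycle_on s -> u \in s -> g u u = 1.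
Proof. by move=> gs us; apply: (mulgI (g u u)); rewrite gs// mulg1. Qed.

Lemma holonomy_le f a c u w x : holonomy f a c u w x -> a <= c.
Proof.
elim=> [//|{}a b {}c {}u v {}w {}x y _ ab _ bc]; exact: le_trans ab bc.
Qed.

Lemma holonomy_mem f a c u w x :
  holonomy f a c u w x -> u \in f a /\ w \in f c.
Proof. by elim=> [//|{}a b {}c {}u v {}w {}x y _ [? _] _ [_ ?]]. Qed.

Section Functional.
Variable f : R -> {set T}.
Hypothesis fg : forall t, cocycle_on (f t).

(** A piece in the star of [o] can be cut at any [v \in f b], because the inserted factor
    [g o v * g v o] is trivial on [f b]. This lets two subdivisions be compared. *)
Lemma holonomy_split a c u w x : holonomy f a c u w x ->
  forall b v, a <= b <= c -> v \in f b ->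
  exists x1 x2,
    [/\ holonomy f a b u v x1, holonomy f b c v w x2 & x = x1 * x2].
Proof.
elim=> [{}a {}c {}u o {}w ac ua wc ofs b v /andP[ab bc] vb|].
  exists (g u o * g o v), (g v o * g o w); split.
  - apply: holonomy_star => // t /andP[? tb].
    by apply: ofs; apply/andP; split=> //; exact: le_trans bc.
  - apply: holonomy_star => // t /andP[bt ?].
    by apply: ofs; apply/andP; split=> //; exact: le_trans bt.
  - have ob : o \in f b by apply: ofs; rewrite ab.
    rewrite -!mulgA; congr (_ * _); rewrite !mulgA (@fg b _ _ _ ob vb ob).
    by rewrite (cocycle_on_refl (@fg b) ob) mul1g.
move=> {}a b' {}c {}u v' {}w {}x y h1 ih1 h2 ih2 b v /andP[ab bc] vb.
have [bb'|/ltW b'b] := leP b b'.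
  have [|x1 [x2 [k1 k2 ->]]] := ih1 b v _ vb; first by rewrite ab.
  by exists x1, (x2 * y); split => //; [exact: holonomy_cat k2 h2|rewrite mulgA].
have [|x1 [x2 [k1 k2 ->]]] := ih2 b v _ vb; first by rewrite b'b.
by exists (x * x1), x2; split => //; [exact: holonomy_cat h1 k1|rewrite mulgA].
Qed.

(** The cocycle identity at the ends of each piece reroutes the piece through [v]; the detours at
    the cuts then cancel. *)
Lemma holonomy_star_inj a c u v w x : (forall t, a <= t <= c -> v \in f t) ->
  holonomy f a c u w x -> x = g u v * g v w.
Proof.
move=> vf h; elim: h vf => [{}a {}c {}u o {}w ac ua wc ofs vf|].
  have [oa oc] : o \in f a /\ o \in f c by rewrite !ofs// lexx ac.
  have [va vc] : v \in f a /\ v \in f c by rewrite !vf// lexx ac.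
  by rewrite -(@fg a _ _ _ ua va oa) -mulgA (@fg c _ _ _ vc oc wc).
move=> {}a b {}c {}u o {}w {}x y h1 ih1 h2 ih2 vf.
have [ab bc] := (holonomy_le h1, holonomy_le h2).
rewrite ih1; last by move=> t /andP[? tb]; rewrite vf// (le_trans tb) ?andbT.
rewrite ih2; last by move=> t /andP[bt ?]; rewrite vf// (le_trans _ bt).
have ob : o \in f b by have [] := holonomy_mem h1.
have vb : v \in f b by rewrite vf// ab.
rewrite -!mulgA; congr (_ * _); rewrite !mulgA (@fg b _ _ _ vb ob vb).
by rewrite (cocycle_on_refl (@fg b) vb) mul1g.
Qed.

(** Induction on the first derivation, splitting the second at the same cuts, reduces to a single
    star. *)
Lemma holonomy_inj a c u w x y :
  holonomy f a c u w x -> holonomy f a c u w y -> x = y.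
Proof.
move=> h; elim: h y => [{}a {}c {}u v {}w ac ua wc vf y|].
  by move/(holonomy_star_inj vf).
move=> {}a b {}c {}u v {}w {}x x' h1 ih1 h2 ih2 y.
move=> /holonomy_split/(_ b v)[||y1 [y2 [k1 k2 ->]]].
- by rewrite (holonomy_le h1) (holonomy_le h2).
- by have [] := holonomy_mem h1.
by rewrite (ih1 _ k1) (ih2 _ k2).
Qed.

End Functional.

Lemma holonomy_affine f f' (k d : R) a c u w x : (0 < k)%R ->
  holonomy f a c u w x ->
  (forall t, (a <= k * t + d <= c)%R -> f' t = f (k * t + d)%R) ->
  holonomy f' ((a - d) / k)%R ((c - d) / k)%R u w x.
Proof.
move=> k0.
have kK t : (k * ((t - d) / k) + d)%R = t.
  by rewrite mulrC mulfVK ?gt_eqF// subrK.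
elim=> [{}a {}c {}u v {}w ac ua wc vf ff'|].
  apply: holonomy_star.
  - by rewrite ler_pM2r ?invr_gt0// lerD2r.
  - by rewrite ff' kK// lexx ac.
  - by rewrite ff' kK// lexx ac.
  - move=> t; rewrite ler_pdivrMr// ler_pdivlMr// lerBlDr lerBrDr mulrC => tac.
    by rewrite ff'// vf.
move=> {}a b {}c {}u v {}w {}x y h1 ih1 h2 ih2 ff'.
have [ab bc] := (holonomy_le h1, holonomy_le h2).
apply: holonomy_cat (ih1 _) (ih2 _) => t /andP[? ?]; apply: ff'.
  by apply/andP; split=> //; exact: le_trans bc.
by apply/andP; split=> //; exact: le_trans ab _.
Qed.

(** Both families are cut at the same times with the same star vertices, so the products are
    identical. *)
Lemma holonomy_common f f' (n : nat) u :
  (forall i, (i <= n)%N -> exists v, forall t,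
     (i%:R <= n.+1%:R * t <= i.+1%:R)%R -> v \in f t /\ v \in f' t) ->
  u \in f 0%R -> u \in f' 0%R ->
  forall w, w \in f 1%R -> w \in f' 1%R ->
  exists x, holonomy f 0%R 1%R u w x /\ holonomy f' 0%R 1%R u w x.
Proof.
move=> cov uf uf' w wf wf'; have n0 : (0 < n.+1%:R :> R)%R by rewrite ltr0n.
suff: forall i, (i <= n.+1)%N -> forall w,
    w \in f (i%:R / n.+1%:R)%R -> w \in f' (i%:R / n.+1%:R)%R ->
  exists x, holonomy f 0%R (i%:R / n.+1%:R)%R u w x /\
            holonomy f' 0%R (i%:R / n.+1%:R)%R u w x.
  by move=> /(_ _ (leqnn _) w); rewrite divff ?gt_eqF//; apply.
elim=> [_|i ih iN] {wf wf'}w.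
  (* The interval is the single time 0, where [u] itself serves as star vertex. *)
  rewrite mul0r => wf wf'; exists (g u u * g u w).
  by split; apply: holonomy_star => // t; rewrite -eq_le => /eqP <-.
have [v vf] := cov i iN.
have seg t : ((i%:R / n.+1%:R <= t <= i.+1%:R / n.+1%:R) =
             (i%:R <= n.+1%:R * t <= i.+1%:R))%R.
  by rewrite ler_pdivrMr// ler_pdivlMr// mulrC.
have ii : (i%:R / n.+1%:R <= i.+1%:R / n.+1%:R :> R)%R.
  by rewrite ler_pM2r ?invr_gt0// ler_nat.
have [vi vi'] : v \in f (i%:R / n.+1%:R)%R /\ v \in f' (i%:R / n.+1%:R)%R.
  by apply: vf; rewrite -seg lexx ii.
move=> wf wf'; have [x [h h']] := ih (ltnW iN) v vi vi'.
exists (x * (g v v * g v w)); split.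
- by apply: holonomy_cat h _; apply: holonomy_star => // t; rewrite seg => /vf[].
- by apply: holonomy_cat h' _; apply: holonomy_star => // t; rewrite seg => /vf[].
Qed.

End Holonomy.

(** * Transport of the fundamental groupoid to one base point, and subpaths *)

Section Groupoid.
Local Open Scope classical_set_scope.
Local Open Scope ring_scope.
Context {R : realType} {X : topologicalType}.
Local Notation I := (unit_interval R).
Local Notation "{ 'path' x ~> y }" := {path I from x to y in X}
  (at level 0, x at level 69, y at level 69).

(** This instance and the next allow rewriting paths up to homotopy. *)
#[local] Instance path_homotopic_equivalence (x y : X) :
  RelationClasses.Equivalence (@path_homotopic R X x y).
Proof.
split; first exact: path_homotopic_refl.
  by move=> p q; exact: path_homotopic_sym.
by move=> p q r; exact: path_homotopic_trans.
Qed.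

#[local] Instance cat_path_proper (x y z : X) :
  Morphisms.Proper (Morphisms.respectful (@path_homotopic R X x y)
    (Morphisms.respectful (@path_homotopic R X y z) (@path_homotopic R X x z)))
    (@Defs.cat_path R X x y z).
Proof. by move=> p p' pp' q q' qq'; exact: path_homotopic_cat. Qed.

Lemma path_homotopic_catK x y z (p : {path x ~> y}) (q : {path y ~> z}) :
  path_homotopic (cat_path (cat_path p q) (rev_path q)) p.
Proof.
rewrite -path_homotopic_catA path_homotopic_catpV.
exact: path_homotopic_catp1.
Qed.

Lemma path_homotopic_catVK x y z (p : {path x ~> y}) (q : {path z ~> y}) :
  path_homotopic (cat_path (cat_path p (rev_path q)) q) p.
Proof.
rewrite -path_homotopic_catA path_homotopic_catVp.
exact: path_homotopic_catp1.
Qed.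

Lemma loop_classM b (p q : {path b ~> b}) :
  (loop_class p * loop_class q)%g = loop_class (cat_path p q).
Proof. exact: pi1_mulE. Qed.

Section Transport.
Variables (b : X) (gamma : forall x, {path b ~> x}).

(** Closing paths up by the chosen [gamma] turns arbitrary paths into elements of one group,
    functorially. *)
Definition transport x y (p : {path x ~> y}) : fundamental_group R b :=
  loop_class (cat_path (cat_path (gamma x) p) (rev_path (gamma y))).

Lemma transport_homotopic x y (p q : {path x ~> y}) :
  path_homotopic p q -> transport p = transport q.
Proof. by move=> pq; apply/loop_classP; rewrite pq; reflexivity. Qed.

Lemma transport_cat x y z (p : {path x ~> y}) (q : {path y ~> z}) :
  transport (cat_path p q) = (transport p * transport q)%g.
Proof.
rewrite /transport loop_classM; apply/loop_classP.
by rewrite !path_homotopic_catA path_homotopic_catVK; reflexivity.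
Qed.

Lemma transport_cst x : transport (cst_path x) = 1%g.
Proof.
apply/loop_classP; rewrite path_homotopic_catp1; exact: path_homotopic_catpV.
Qed.

Lemma transport_inj x y (p q : {path x ~> y}) :
  transport p = transport q -> path_homotopic p q.
Proof.
have K (r : {path x ~> y}) : path_homotopic (cat_path (cat_path (rev_path (gamma x))
    (cat_path (cat_path (gamma x) r) (rev_path (gamma y)))) (gamma y)) r.
  rewrite !path_homotopic_catA path_homotopic_catVK path_homotopic_catVp.
  exact: path_homotopic_cat1p.
by move=> /loop_classP pq; rewrite -(K p) pq K; reflexivity.
Qed.

Lemma transport_surj x y (z : fundamental_group R b) :
  exists p : {path x ~> y}, transport p = z.
Proof.
have [p ->] := loop_class_surj z.
exists (cat_path (cat_path (rev_path (gamma x)) p) (gamma y)); apply/loop_classP.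
rewrite !path_homotopic_catA path_homotopic_catK path_homotopic_catpV.
exact: path_homotopic_cat1p.
Qed.

(** Needed when the ends of two paths are equal but not convertible, as for a path and its [subpath]
    from 0 to 1. *)
Lemma transport_eq x y x' y' (p : {path x ~> y}) (q : {path x' ~> y'}) :
  x = x' -> y = y' -> p =1 q -> transport p = transport q.
Proof. by move=> xx' yy'; subst x' y' => /path_eqP ->. Qed.

Lemma transport_base (p : {path b ~> b}) :
  path_homotopic (gamma b) (cst_path b) -> transport p = loop_class p.
Proof.
move=> g1; apply/loop_classP.
have r1 : path_homotopic (rev_path (cst_path b)) (cst_path b : {path b ~> b}).
  rewrite -(path_homotopic_cat1p (rev_path _)); exact: path_homotopic_catpV.
rewrite (path_homotopic_rev g1) g1 r1 path_homotopic_cat1p path_homotopic_catp1.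
reflexivity.
Qed.

Definition base_change (x : X) (z : fundamental_group R x) :
  fundamental_group R b := transport (repr z).

Lemma base_changeE x (p : {path x ~> x}) :
  base_change (loop_class p) = transport p.
Proof. by apply/transport_homotopic/loop_classP; rewrite loop_class_repr. Qed.

Fact base_change_multiplicative x : {morph @base_change x : y z / (y * z)%g}.
Proof.
move=> y z; have [p ->] := loop_class_surj y; have [q ->] := loop_class_surj z.
by rewrite loop_classM !base_changeE transport_cat.
Qed.

HB.instance Definition _ x := isMultiplicative.Build _ _ (@base_change x)
  (@base_change_multiplicative x).

Lemma base_change_bij x : bijective (@base_change x).
Proof.
have surj (z : fundamental_group R b) :
    exists y : fundamental_group R x, base_change y == z.
  have [p <-] := transport_surj x x z.
  by exists (loop_class p); rewrite base_changeE.
exists (fun z => xchoose (surj z)) => z; last by apply/eqP; exact: (xchooseP (surj z)).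
have [p ->] := loop_class_surj z.
have [q] := loop_class_surj (xchoose (surj (base_change (loop_class p)))).
have /eqP := xchooseP (surj (base_change (loop_class p))).
by move=> + qE; rewrite qE !base_changeE => /transport_inj/loop_classP.
Qed.

End Transport.

Lemma continuous_addr (Y : topologicalType) (f g : Y -> R) :
  continuous f -> continuous g -> continuous (fun y => f y + g y).
Proof.
by move=> cf cg y; apply: (@continuousD _ _ _ f g); [exact: cf|exact: cg].
Qed.

Definition subpath x y (p : {path x ~> y}) (a c : R) :
    {path path_ext p a ~> path_ext p c}.
Proof.
refine (@mk_path I X _ _ (fun t => path_ext p ((c - a) * uval t + a)) _ _ _).
- apply: (@continuous_compose _ _ _ _ (path_ext p)); last exact: path_ext_continuous.
  exact: continuous_affine (@uval_continuous R).
- by rewrite uval0 mulr0 add0r.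
- by rewrite uval1 mulr1 subrK.
Defined.

Lemma subpath_ext x y (p : {path x ~> y}) a c r : 0 <= r <= 1 ->
  path_ext (subpath p a c) r = path_ext p ((c - a) * r + a).
Proof.
by move=> r01; rewrite {1}/path_ext -[LHS]/(path_ext p _) uval_clamp.
Qed.

Lemma subpath_cat x y (p : {path x ~> y}) a b c :
  path_homotopic (subpath p a c) (cat_path (subpath p a b) (subpath p b c)).
Proof.
(* Piecewise affine, from [a] to [b] on the first half and from [b] to [c] on the second; as a sum
   of truncated affine maps it is continuous. *)
pose psi r : R := ((b - a) * Num.min (2 * r + 0) 1 + a) +
    ((c - b) * Num.max (2 * r - 1) 0 + 0).
apply: (@path_homotopic_reparam _ _ _ _ _ _ p _ _ (fun r => (c - a) * r + a) psi).
- exact: continuous_affine_id.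
- apply: continuous_addr; apply: continuous_affine.
    apply: continuous_minr => s.
      exact: continuous_affine_id.
    exact: cvg_cst.
  apply: continuous_maxr => s.
    exact: continuous_affine_id.
  exact: cvg_cst.
- by rewrite /psi minElt maxElt; do 2 case: ifP; lra.
- by rewrite /psi minElt maxElt; do 2 case: ifP; lra.
- by move=> r r01; rewrite subpath_ext.
- move=> r r01; rewrite cat_path_ext /psi addr0; have [r2|r2] := leP r 2^-1.
    rewrite subpath_ext; last by lra.
    rewrite (min_idPl _) ?(max_idPr _); [|lra..].
    by congr path_ext; lra.
  rewrite subpath_ext; last by lra.
  rewrite (min_idPr _) ?(max_idPl _); [|lra..].
  by congr path_ext; lra.
Qed.

End Groupoid.

(** * Barycentric coordinates, straight-line homotopies and subdivision into open stars *)

Section Realization.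
Local Open Scope classical_set_scope.
Local Open Scope ring_scope.
Context {R : realType} {T : finType} {K : {set {set T}}}.
Local Notation X := (realization R K).
Implicit Types (x y : X) (v : T).

Definition bary (x : X) (v : T) : R := (set_val x : T -> R) v.

(** The smallest face containing [x]; its elements are the vertices whose open star contains [x]. *)
Definition carrier (x : X) : {set T} := [set v | bary x v != 0]%SET.

Lemma bary_realization_set x : realization_set K (bary x : {ptws T -> R}).
Proof. exact: set_valP. Qed.

Lemma bary_ge0 x v : 0 <= bary x v.
Proof. by have [] := bary_realization_set x. Qed.

Lemma sum_bary x : \sum_v bary x v = 1.
Proof. by have [] := bary_realization_set x. Qed.

Lemma carrier_simplex x : carrier x \in K.
Proof. by have [] := bary_realization_set x. Qed.

Lemma bary_inj x y : bary x =1 bary y -> x = y.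
Proof. by move=> /funext xy; apply: val_inj; exact: xy. Qed.

Lemma mem_carrier x v : (v \in carrier x) = (bary x v != 0).
Proof. by rewrite inE. Qed.

Lemma carrier_neq0 x : exists v, v \in carrier x.
Proof.
have [//|x0] := pselect (exists v, v \in carrier x).
have /eqP := sum_bary x; rewrite big1 ?(eq_sym 0) ?oner_eq0// => v _.
by apply/eqP; apply: contra_notT x0 => xv; exists v; rewrite mem_carrier.
Qed.

Lemma bary_continuous v : continuous (fun x => bary x v).
Proof.
apply: (@continuous_compose _ {ptws T -> R} _ set_val (proj v)).
  exact: initial_continuous.
exact: (@proj_continuous T (fun=> R)).
Qed.

Lemma realization_continuous (Y : topologicalType) (f : Y -> X) :
  (forall v, continuous (fun a => bary (f a) v)) -> continuous f.
Proof.
move=> cf; apply: continuous_comp_initial => a.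
apply/cvg_sup => v; move: a.
apply/(@continuousP _ (initial_topology (fun h : T -> R => h v))) => A [B oB <-].
by apply: open_comp oB => a _; exact: cf.
Qed.

Lemma open_star v : open [set x | v \in carrier x].
Proof.
have -> : [set x | v \in carrier x] = (bary ^~ v) @^-1` [set~ 0].
  by apply/seteqP; split=> x /=; rewrite mem_carrier => /eqP.
apply: open_comp; last by rewrite openC; exact: closed_eq.
by move=> x _; exact: bary_continuous.
Qed.

(** The junk value [x] is taken when the affine combination leaves the realization; this does not
    happen for [t] in the unit interval when the two carriers span a face. *)
Definition mix x y (t : R) : X :=
  insubd x ((fun v => (1 - t) * bary x v + t * bary y v) : {ptws T -> R}).

Hypothesis hK : simplicial_complex K.

Lemma bary_mix x y t v : 0 <= t <= 1 -> carrier x :|: carrier y \in K ->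
  bary (mix x y t) v = (1 - t) * bary x v + t * bary y v.
Proof.
move=> /andP[t0 t1] xyK; rewrite /bary /mix set_valE insubdK//.
have ge0 u : 0 <= (1 - t) * bary x u + t * bary y u.
  by rewrite addr_ge0 ?mulr_ge0 ?bary_ge0// subr_ge0.
apply/mem_set; split => //.
  by rewrite big_split/= -!mulr_sumr !sum_bary !mulr1 subrK.
apply: hK.2 xyK _; apply/fintype.subsetP => u; rewrite !finset.in_setU !inE.
by apply: contraNT; rewrite negb_or !negbK => /andP[/eqP -> /eqP ->]; rewrite !mulr0 addr0.
Qed.

Lemma carrier_mix x y t : 0 <= t <= 1 -> carrier x :|: carrier y \in K ->
  carrier (mix x y t) \subset carrier x :|: carrier y.
Proof.
move=> t01 xyK; apply/fintype.subsetP => u.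
rewrite finset.in_setU !mem_carrier (bary_mix _ t01 xyK).
by apply: contraNT; rewrite negb_or !negbK => /andP[/eqP -> /eqP ->]; rewrite !mulr0 addr0.
Qed.

Lemma mem_carrier_mixl x y t v : 0 <= t < 1 -> carrier x :|: carrier y \in K ->
  v \in carrier x -> v \in carrier (mix x y t).
Proof.
move=> /andP[t0 t1] xyK; rewrite !mem_carrier bary_mix// ?t0 ?ltW// => xv.
rewrite gt_eqF// ltr_wpDr ?mulr_ge0 ?bary_ge0// mulr_gt0 ?subr_gt0//.
by rewrite lt_neqAle eq_sym xv bary_ge0.
Qed.

Lemma mem_carrier_mixr x y t v : 0 < t <= 1 -> carrier x :|: carrier y \in K ->
  v \in carrier y -> v \in carrier (mix x y t).
Proof.
move=> /andP[t0 t1] xyK; rewrite !mem_carrier bary_mix// ?t1 ?ltW// => yv.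
rewrite gt_eqF// ltr_wpDl ?mulr_ge0 ?bary_ge0 ?subr_ge0// mulr_gt0//.
by rewrite lt_neqAle eq_sym yv bary_ge0.
Qed.

Lemma mix0 x y : carrier x :|: carrier y \in K -> mix x y 0 = x.
Proof.
move=> xyK; apply: bary_inj => v.
by rewrite bary_mix ?lexx ?ler01// subr0 mul1r mul0r addr0.
Qed.

Lemma mix1 x y : carrier x :|: carrier y \in K -> mix x y 1 = y.
Proof.
move=> xyK; apply: bary_inj => v.
by rewrite bary_mix ?lexx ?ler01// subrr mul0r mul1r add0r.
Qed.

Lemma mixxx x t : 0 <= t <= 1 -> mix x x t = x.
Proof.
move=> t01; apply: bary_inj => v.
by rewrite bary_mix ?finset.setUid ?carrier_simplex// -mulrDl subrK mul1r.
Qed.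

Lemma mix_continuous (Y : topologicalType) (p q : Y -> X) (h : Y -> R) :
  continuous p -> continuous q -> continuous h ->
  (forall a, 0 <= h a <= 1) ->
  (forall a, carrier (p a) :|: carrier (q a) \in K) ->
  continuous (fun a => mix (p a) (q a) (h a)).
Proof.
move=> cp cq ch h01 pqK; apply: realization_continuous => v.
under eq_fun do rewrite bary_mix//.
have cp' := continuous_compose cp (@bary_continuous v).
have cq' := continuous_compose cq (@bary_continuous v).
move=> a; apply: (@continuousD _ _ _ (fun a => (1 - h a) * bary (p a) v)
                    (fun a => h a * bary (q a) v)).
  apply: (@continuousM _ _ (fun a => 1 - h a) (fun a => bary (p a) v)).
    by apply: continuousB; [exact: cvg_cst|exact: ch].
  exact: cp'.
by apply: continuousM; [exact: ch|exact: cq'].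
Qed.

Local Notation I := (unit_interval R).
Local Notation "{ 'path' x ~> y }" := {path I from x to y in X}
  (at level 0, x at level 69, y at level 69).

Section Segment.
Context {x y : X} (xyK : carrier x :|: carrier y \in K).

Fact segment_continuous : continuous (fun t : I => mix x y (uval t)).
Proof.
apply: (@mix_continuous _ (fun=> x) (fun=> y)) => //.
- exact: cst_continuous.
- exact: cst_continuous.
- exact: uval_continuous.
- exact: uval_itv.
Qed.

Fact segment_zero : mix x y (uval (zero : I)) = x.
Proof. by rewrite uval0 mix0. Qed.

Fact segment_one : mix x y (uval (one : I)) = y.
Proof. by rewrite uval1 mix1. Qed.

Definition segment : {path x ~> y} :=
  mk_path segment_continuous segment_zero segment_one.

Lemma carrier_segment t : carrier (segment t) \subset carrier x :|: carrier y.
Proof. by rewrite carrier_mix ?uval_itv. Qed.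

End Segment.

(** The straight-line homotopy stays in the realization, and it fixes the ends because [mix x x t]
    is [x]. *)
Lemma contiguous_homotopic x y (p q : {path x ~> y}) :
  (forall t, carrier (p t) :|: carrier (q t) \in K) -> path_homotopic p q.
Proof.
move=> pqK; exists (fun ts => mix (p ts.1) (q ts.1) (uval ts.2)); split => /=.
- have c1 : continuous (fun ts : I * I => ts.1) by move=> ?; exact: cvg_fst.
  have c2 : continuous (fun ts : I * I => ts.2) by move=> ?; exact: cvg_snd.
  apply: mix_continuous => //; last by move=> ?; exact: uval_itv.
  + exact: continuous_compose c1 (@cts_fun _ _ p).
  + exact: continuous_compose c1 (@cts_fun _ _ q).
  + exact: continuous_compose c2 (@uval_continuous R).
- by move=> t; rewrite uval0 mix0.
- by move=> t; rewrite uval1 mix1.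
- by move=> s; rewrite !path_zero !path_one !mixxx ?uval_itv.
Qed.

Lemma cat_path_ind x y z (p : {path x ~> y}) (q : {path y ~> z}) (P : X -> Prop) :
  (forall t, P (p t)) -> (forall t, P (q t)) -> forall t, P (cat_path p q t).
Proof. by move=> Pp Pq t; rewrite -[cat_path p q t]/(cat_fun p q t) /cat_fun; case: ifP. Qed.

Lemma cat_path_ind2 x y z (p : {path x ~> y}) (q : {path y ~> z})
    x' y' z' (p' : {path x' ~> y'}) (q' : {path y' ~> z'}) (P : X -> X -> Prop) :
  (forall t, P (p t) (p' t)) -> (forall t, P (q t) (q' t)) ->
  forall t, P (cat_path p q t) (cat_path p' q' t).
Proof.
move=> Pp Pq t; rewrite -[cat_path p q t]/(cat_fun p q t).
by rewrite -[cat_path p' q' t]/(cat_fun p' q' t) /cat_fun; case: ifP.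
Qed.

(** Replaces a piece of path inside a star by two segments, as [holonomy_star] does with labels. *)
Lemma star_homotopic x y e (p : {path x ~> y})
    (xeK : carrier x :|: carrier e \in K) (eyK : carrier e :|: carrier y \in K) :
  (forall t, carrier e \subset carrier (p t)) ->
  path_homotopic p (cat_path (segment xeK) (segment eyK)).
Proof.
move=> ep.
(* Once [p] is padded with constants at both ends, it is contiguous to the
   path that waits at [e] while [p] runs. *)
have step : path_homotopic (cat_path (cst_path x) (cat_path p (cst_path y)))
    (cat_path (segment xeK) (cat_path (cst_path e) (segment eyK))).
  apply: contiguous_homotopic.
  pose P a b := carrier a :|: carrier b \in K.
  apply: (@cat_path_ind2 _ _ _ _ _ _ _ _ _ _ P) => [t|].
    apply: (hK.2 _ _ xeK); rewrite /P finset.subUset finset.subsetUl/=.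
    exact: carrier_segment.
  apply: (@cat_path_ind2 _ _ _ _ _ _ _ _ _ _ P) => t.
    rewrite /P (finset.setUidPl _) ?carrier_simplex//; exact: ep.
  apply: (hK.2 _ _ eyK); rewrite /P finset.subUset finset.subsetUr/=.
  exact: carrier_segment.
apply: path_homotopic_trans (path_homotopic_sym (path_homotopic_cat1p p)) _.
apply: (@path_homotopic_trans _ _ _ _ (cat_path (cst_path x) (cat_path p (cst_path y)))).
  apply: path_homotopic_cat (path_homotopic_refl _) _.
  exact: path_homotopic_sym (path_homotopic_catp1 p).
apply: path_homotopic_trans step _.
by apply: path_homotopic_cat (path_homotopic_refl _) (path_homotopic_cat1p _).
Qed.

(** A Lebesgue number argument for the cover of the compact unit square by preimages of open
    stars. *)
Lemma star_subdivision (H : R * R -> X) : continuous H ->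
  exists n : nat, forall i j : nat, (i <= n)%N -> (j <= n)%N ->
  exists v, forall t s, i%:R <= n.+1%:R * t <= i.+1%:R ->
    j%:R <= n.+1%:R * s <= j.+1%:R -> v \in carrier (H (t, s)).
Proof.
move=> cH.
have sq : compact (`[0, 1 : R] `*` `[0, 1 : R]).
  by apply: compact_setX; exact: segment_compact.
pose P (n : nat) (z : R * R) :=
  exists v, forall z', ball z n.+1%:R^-1 z' -> v \in carrier (H z').
have /compact_near_coveringP/(_ _ \oo P) := sq.
have locP (z : R * R) : (`[0, 1] `*` `[0, 1]) z -> \forall z' \near z & n \near \oo, P n z'.
  move=> _; have [v vz] := carrier_neq0 (H z).
  have /nbhs_ballP[e /= e0 eP] : nbhs z (H @^-1` [set x | v \in carrier x]).
    by apply: cH; apply: open_nbhs_nbhs; split => //; exact: open_star.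
  (* Half of the radius is kept for the ball around the moving centre [z']. *)
  exists (ball z (e / 2), [set n | n.+1%:R^-1 < e / 2]) => /=.
    split; first by apply: nbhsx_ballx; rewrite divr_gt0.
    exact: near_infty_natSinv_lt (PosNum (divr_gt0 e0 (ltr0n _ 2))).
  move=> [z' n] /= [zz' ne]; exists v => z'' z'z''; apply: eP.
  by rewrite [e]splitr; apply: ball_triangle zz' _; apply: le_ball z'z''; exact: ltW.
move=> /(_ _ locP) [n _ /(_ n (leqnn n)) nP].
exists n => i j ni nj.
have n0 : 0 < n.+1%:R :> R by rewrite ltr0n.
(* The midpoints of the cells; the points of a cell are within half the radius of the ball. *)
pose c (k : nat) : R := (k%:R + 2^-1) / n.+1%:R.
have c01 k : (k <= n)%N -> [set` `[0, 1 : R]] (c k).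
  move=> kn; rewrite /= in_itv /= divr_ge0 ?addr_ge0//= ler_pdivrMr// mul1r.
  have : k%:R <= n%:R :> R by rewrite ler_nat.
  by rewrite -(natr1 n); lra.
have cb k t : k%:R <= n.+1%:R * t <= k.+1%:R -> ball (c k) n.+1%:R^-1 t.
  move=> kt; rewrite -ball_normE /= /c.
  have -> : (k%:R + 2^-1) / n.+1%:R - t = (k%:R + 2^-1 - n.+1%:R * t) / n.+1%:R.
    by rewrite mulrBl mulrAC divff ?gt_eqF// mul1r.
  rewrite normrM normfV (gtr0_norm n0) ltr_pdivrMr// mulVf ?gt_eqF// ltr_norml.
  by move: kt; rewrite -(natr1 k); lra.
have [|v vP] := nP (c i, c j); first by split; exact: c01.
by exists v => t s ti sj; apply: vP; split; exact: cb.
Qed.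

End Realization.

(** * The fundamental group of a complex with all vertices joined to [b] *)

Section EdgeLoops.
Local Open Scope classical_set_scope.
Local Open Scope ring_scope.
Context {R : realType} {T : finType} {K : {set {set T}}}.
Hypothesis hK : simplicial_complex K.
Local Notation X := (realization R K).
Local Notation I := (unit_interval R).
Local Notation "{ 'path' x ~> y }" := {path I from x to y in X}
  (at level 0, x at level 69, y at level 69).

Lemma indicator_realization_set v : [set v]%SET \in K ->
  realization_set K ((fun w => (w == v)%:R) : {ptws T -> R}).
Proof.
move=> vK; split=> [w||]; first by rewrite ler0n.
  by rewrite (bigD1 v)//= eqxx big1 ?addr0// => w /negbTE ->.
suff -> : [set w | (w == v)%:R != 0 :> R]%SET = [set v]%SET by [].
by apply/setP => w; rewrite !inE pnatr_eq0 eqb0 negbK.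
Qed.

Lemma realization_inhabited v : [set v]%SET \in K -> inhabited X.
Proof.
move=> /indicator_realization_set/mem_set h.
by constructor; exact: (exist (fun x => x \in realization_set K) _ h).
Qed.

Variable x0 : X.

(* The junk value of [vertex v] is [x0] when [v] is not a vertex of [K]. *)
Definition vertex (v : T) : X :=
  insubd x0 ((fun w => (w == v)%:R) : {ptws T -> R}).

Lemma carrier_vertex v : [set v]%SET \in K -> carrier (vertex v) = [set v]%SET.
Proof.
move=> vK; apply/setP => w; rewrite mem_carrier /bary /vertex set_valE insubdK.
  by rewrite pnatr_eq0 eqb0 negbK inE.
exact/mem_set/indicator_realization_set.
Qed.

Variable b : T.
Hypothesis bK : [set b]%SET \in K.
Hypothesis b_cone : forall v, [set v]%SET \in K -> [set b; v]%SET \in K.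

Lemma vertex_simplex (s : {set T}) v : s \in K -> v \in s -> [set v]%SET \in K.
Proof. by move=> sK vs; apply: hK.2 sK _; rewrite finset.sub1set. Qed.

Lemma carrier_vertex_sub (s : {set T}) v :
  s \in K -> v \in s -> carrier (vertex v) \subset s.
Proof.
by move=> sK vs; rewrite carrier_vertex ?finset.sub1set//; exact: vertex_simplex vs.
Qed.

Lemma join_simplex (s : {set T}) (x y : X) : s \in K ->
  carrier x \subset s -> carrier y \subset s -> carrier x :|: carrier y \in K.
Proof. by move=> sK xs ys; apply: hK.2 sK _; rewrite finset.subUset xs. Qed.

(** Everything happens in the closed simplex [s], which is convex. *)
Lemma segment_cat (s : {set T}) (x y z : X) (xy : carrier x :|: carrier y \in K)
    (yz : carrier y :|: carrier z \in K) (xz : carrier x :|: carrier z \in K) :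
  s \in K -> carrier x \subset s -> carrier y \subset s -> carrier z \subset s ->
  path_homotopic (cat_path (segment hK xy) (segment hK yz)) (segment hK xz).
Proof.
move=> sK xs ys zs; apply: (contiguous_homotopic hK) => t.
apply: (join_simplex sK).
  apply: (cat_path_ind (P := fun p => carrier p \subset s)) => {}t;
    by apply: fintype.subset_trans (carrier_segment _ _ _) _; rewrite finset.subUset ?xs ?ys.
by apply: fintype.subset_trans (carrier_segment _ _ _) _; rewrite finset.subUset xs.
Qed.

Lemma segment_cst (x : X) (xx : carrier x :|: carrier x \in K) :
  path_homotopic (segment hK xx) (cst_path x).
Proof.
apply: (contiguous_homotopic hK) => t.
apply: (join_simplex xx); first exact: carrier_segment.
exact: finset.subsetUl.
Qed.

Definition some_vertex (x : X) : T := xchoose (carrier_neq0 x).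

Lemma some_vertexP x : some_vertex x \in carrier x.
Proof. exact: xchooseP. Qed.

Fact spoke_simplex v : [set v]%SET \in K ->
  carrier (vertex b) :|: carrier (vertex v) \in K.
Proof. by move=> vK; rewrite !carrier_vertex ?b_cone. Qed.

Fact some_vertex_simplex x : [set some_vertex x]%SET \in K.
Proof. exact: vertex_simplex (carrier_simplex x) (some_vertexP x). Qed.

Fact some_vertex_join x : carrier (vertex (some_vertex x)) :|: carrier x \in K.
Proof.
apply: join_simplex (carrier_simplex x) _ _ => //.
exact: carrier_vertex_sub (carrier_simplex x) (some_vertexP x).
Qed.

(** Every point is reached from [b] through a chosen vertex of its carrier; these are the paths used
    for transport. *)
Definition spoke (x : X) : {path vertex b ~> x} :=
  cat_path (segment hK (spoke_simplex (some_vertex_simplex x)))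
           (segment hK (some_vertex_join x)).

Lemma spoke_vertex v (vK : [set v]%SET \in K) :
  path_homotopic (spoke (vertex v)) (segment hK (spoke_simplex vK)).
Proof.
have vE : some_vertex (vertex v) = v.
  by apply/eqP; have := some_vertexP (vertex v); rewrite carrier_vertex// inE.
apply: (segment_cat (s := [set b; v]%SET)); first exact: b_cone.
- by rewrite carrier_vertex_sub ?b_cone// !inE eqxx.
- by rewrite vE carrier_vertex_sub ?b_cone// !inE eqxx orbT.
- by rewrite carrier_vertex_sub ?b_cone// !inE eqxx orbT.
Qed.

Lemma spoke_base : path_homotopic (spoke (vertex b)) (cst_path (vertex b)).
Proof.
by apply: path_homotopic_trans (spoke_vertex bK) _; exact: segment_cst.
Qed.

Local Notation transport := (transport spoke).

Lemma realization_path_connected : path_connected R X.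
Proof.
split; first by exists; exact: x0.
by move=> x y; exists; exact: cat_path (rev_path (spoke x)) (spoke y).
Qed.

(* The class of the loop b, u, v, b when [{u, v}] is a face, junk otherwise. *)
Definition edge_class (u v : T) : fundamental_group R (vertex b) :=
  if pselect (carrier (vertex u) :|: carrier (vertex v) \in K) is left uv
  then transport (segment hK uv) else 1%g.

Lemma edge_classE u v (uv : carrier (vertex u) :|: carrier (vertex v) \in K) :
  edge_class u v = transport (segment hK uv).
Proof.
rewrite /edge_class; case: pselect => // uv'.
by rewrite (bool_irrelevance uv uv').
Qed.

Lemma transport_segment_cat (s : {set T}) (x y z : X)
    (xy : carrier x :|: carrier y \in K)
    (yz : carrier y :|: carrier z \in K) (xz : carrier x :|: carrier z \in K) :
  s \in K -> carrier x \subset s -> carrier y \subset s -> carrier z \subset s ->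
  (transport (segment hK xy) * transport (segment hK yz))%g =
  transport (segment hK xz).
Proof.
move=> sK xs ys zs; rewrite -transport_cat.
by apply: transport_homotopic; exact: (segment_cat _ _ _ sK).
Qed.

Lemma edge_class_cocycle s : s \in K -> cocycle_on edge_class s.
Proof.
move=> sK u v w us vs ws.
have [uS vS wS] : [/\ carrier (vertex u) \subset s, carrier (vertex v) \subset s
    & carrier (vertex w) \subset s] by split; exact: carrier_vertex_sub.
rewrite (edge_classE (join_simplex sK uS vS)) (edge_classE (join_simplex sK vS wS)).
rewrite (edge_classE (join_simplex sK uS wS)).
exact: (transport_segment_cat _ _ _ sK).
Qed.

(** Up to homotopy the loop runs out along the edge from [b] to [v] and back along it. *)
Lemma edge_class_base v : [set v]%SET \in K -> edge_class b v = 1%g.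
Proof.
move=> vK; rewrite (edge_classE (spoke_simplex vK)); apply/loop_classP.
apply: path_homotopic_trans (path_homotopic_cat (path_homotopic_cat spoke_base
  (path_homotopic_refl _)) (path_homotopic_rev (spoke_vertex vK))) _.
apply: path_homotopic_trans (path_homotopic_cat (path_homotopic_cat1p _)
  (path_homotopic_refl _)) _.
exact: path_homotopic_catpV.
Qed.

(** The tautological holonomy recovers the path, up to segments joining its ends to [u] and [w]. At
    a cut, the segments to and from the cut vertex cancel. *)
Lemma holonomy_edge_class x y (p : {path x ~> y}) a c u w z :
  holonomy edge_class (carrier \o path_ext p) a c u w z ->
  forall (ux : carrier (vertex u) :|: carrier (path_ext p a) \in K)
         (yw : carrier (path_ext p c) :|: carrier (vertex w) \in K),
  z = (transport (segment hK ux) * transport (subpath p a c) *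
       transport (segment hK yw))%g.
Proof.
have vx v t : v \in carrier (path_ext p t) ->
    carrier (vertex v) \subset carrier (path_ext p t).
  by apply: carrier_vertex_sub; exact: carrier_simplex.
have vxK v t : v \in carrier (path_ext p t) ->
    carrier (vertex v) :|: carrier (path_ext p t) \in K.
  by move=> /vx vp; apply: join_simplex (carrier_simplex _) vp _.
have xvK v t : v \in carrier (path_ext p t) ->
    carrier (path_ext p t) :|: carrier (vertex v) \in K.
  by rewrite finset.setUC; exact: vxK.
have vvK v v' t : v \in carrier (path_ext p t) -> v' \in carrier (path_ext p t) ->
    carrier (vertex v) :|: carrier (vertex v') \in K.
  by move=> /vx vp /vx v'p; apply: join_simplex (carrier_simplex _) vp v'p.
elim=> [{}a {}c {}u v {}w ac /= ua wc vp ux yw|].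
  have [va vc] : v \in carrier (path_ext p a) /\ v \in carrier (path_ext p c).
    by split; apply: vp; rewrite lexx ac.
  rewrite (edge_classE (vvK _ _ _ ua va)) (edge_classE (vvK _ _ _ vc wc)).
  rewrite -(transport_segment_cat ux (xvK _ _ va) _ (carrier_simplex (path_ext p a)))// ?vx//.
  rewrite -(transport_segment_cat (vxK _ _ vc) yw _ (carrier_simplex (path_ext p c)))// ?vx//.
  (* The whole subpath lies in the open star of [v], so it can be pushed through [v]. *)
  suff -> : transport (subpath p a c) = (transport (segment hK (xvK _ _ va)) *
      transport (segment hK (vxK _ _ vc)))%g by rewrite !mulgA.
  rewrite -transport_cat; apply: transport_homotopic.
  apply: (star_homotopic hK) => t; apply: carrier_vertex_sub (carrier_simplex _) _.
  apply: vp; have /andP[t0 t1] := uval_itv t.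
  by rewrite lerDr mulr_ge0 ?subr_ge0//= -lerBrDr ler_piMr ?subr_ge0.
move=> {}a d {}c {}u v {}w z1 z2 h1 ih1 h2 ih2 ux yw.
have [_ /= vd] := holonomy_mem h1.
have ddK : carrier (path_ext p d) :|: carrier (path_ext p d) \in K.
  by rewrite finset.setUid carrier_simplex.
have dd : (transport (segment hK (xvK _ _ vd)) *
    transport (segment hK (vxK _ _ vd)) = 1)%g.
  rewrite (transport_segment_cat _ _ ddK (carrier_simplex (path_ext p d)))// ?vx//.
  by rewrite (transport_homotopic _ (segment_cst ddK)) transport_cst.
rewrite (ih1 ux (xvK _ _ vd)) (ih2 (vxK _ _ vd) yw).
rewrite (transport_homotopic _ (subpath_cat p a d c)) transport_cat.
by rewrite !mulgA -[X in (X * _ * _)%g]mulgA dd mulg1.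
Qed.

Lemma holonomy_exists (G : groupType) (g : T -> T -> G) x y (p : {path x ~> y}) u w :
  u \in carrier x -> w \in carrier y ->
  exists z, holonomy g (carrier \o path_ext p) 0 1 u w z.
Proof.
(* The path is viewed as a map of the square that ignores the second coordinate; only the bottom row
   of cells is used. *)
move=> ux wy; have [n nP] := @star_subdivision R T K (path_ext p \o fst)
  (continuous_compose (fun=> cvg_fst) (@path_ext_continuous _ _ _ _ p)).
have p0 : path_ext p 0 = x by rewrite path_ext_le0.
have p1 : path_ext p 1 = y by rewrite path_ext_ge1.
have [|||||z [pz _]] := @holonomy_common R T G g (carrier \o path_ext p)
    (carrier \o path_ext p) n u _ _ _ w; rewrite /= ?p0 ?p1//; last by exists z.
move=> i ni; have [v vP] := nP i 0%N ni (leq0n n); exists v => t ti.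
by have := vP t 0 ti; rewrite mulr0 lexx ler01 => /(_ isT).
Qed.

(* The holonomies along the rows of a fine grid agree, since neighbouring rows
   can be cut with the same stars. *)
Lemma holonomy_homotopic (G : groupType) (g : T -> T -> G) x y
    (p q : {path x ~> y}) u w z :
  (forall s, s \in K -> cocycle_on g s) -> u \in carrier x -> w \in carrier y ->
  path_homotopic p q -> holonomy g (carrier \o path_ext p) 0 1 u w z ->
  holonomy g (carrier \o path_ext q) 0 1 u w z.
Proof.
move=> gK ux wy [H [cH H0 H1 He]] pz.
pose h (s t : R) : {set T} := carrier (H (clamp t, clamp s)).
have h0 s : h s 0 = carrier x by rewrite /h -[clamp 0]/(@zero I) (He _).1.
have h1 s : h s 1 = carrier y by rewrite /h -[clamp 1]/(@one I) (He _).2.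
have [n nP] : exists n : nat, forall i j : nat, (i <= n)%N -> (j <= n)%N ->
    exists v, forall t s, i%:R <= n.+1%:R * t <= i.+1%:R ->
      j%:R <= n.+1%:R * s <= j.+1%:R -> v \in h s t.
  apply: (@star_subdivision R T K (fun ts => H (clamp ts.1, clamp ts.2))).
  apply: (@continuous_compose _ _ _ _ H) => //; apply: continuous_pair.
    exact: continuous_compose (fun=> cvg_fst) (@clamp_continuous R).
  exact: continuous_compose (fun=> cvg_snd) (@clamp_continuous R).
have n0 : 0 < n.+1%:R :> R by rewrite ltr0n.
have hq : carrier \o path_ext q = h (n.+1%:R / n.+1%:R).
  by apply/funext => t; rewrite divff ?gt_eqF// /h -[clamp 1]/(@one I) H1.
rewrite hq; suff : forall j, (j <= n.+1)%N -> holonomy g (h (j%:R / n.+1%:R)) 0 1 u w z.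
  by apply.
elim=> [_|j ih jn].
  rewrite mul0r; have -> // : h 0 = carrier \o path_ext p.
  by apply/funext => t; rewrite /h -[clamp 0]/(@zero I) H0.
have [|||||z' [jz' jz'1]] := @holonomy_common R T G g (h (j%:R / n.+1%:R))
    (h (j.+1%:R / n.+1%:R)) n u _ _ _ w; rewrite ?h0 ?h1//.
  move=> i ni; have [v vP] := nP i j ni jn; exists v => t ti.
  by split; apply: vP ti _; rewrite mulrCA divff ?gt_eqF// mulr1 !ler_nat ?leqnn ?leqnSn.
suff -> : z = z' by [].
by apply: holonomy_inj (ih (ltnW jn)) jz' => t; exact/gK/carrier_simplex.
Qed.

(** A loop at [b] equals its tautological holonomy, which is a product of edge classes. *)
Lemma edge_class_generate (P : fundamental_group R (vertex b) -> Prop) :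
  (forall u v, [set u; v]%SET \in K -> P (edge_class u v)) ->
  (forall y z, P y -> P z -> P (y * z)%g) -> forall z, P z.
Proof.
move=> PE PM z; have [p ->] := loop_class_surj z.
have bb : b \in carrier (vertex b) by rewrite carrier_vertex// inE.
have [y py] := holonomy_exists edge_class p bb bb.
suff <- : y = loop_class p.
  have pairK u v s : s \in K -> u \in s -> v \in s -> [set u; v]%SET \in K.
    by move=> sK us vs; apply: hK.2 sK _; rewrite finset.subUset !finset.sub1set us.
  elim: py => [a c u v w ac /= ua wc vp|a d c u v w y1 y2 _ P1 _ P2]; last exact: PM.
  by apply: PM; apply: PE;
    [apply: pairK (carrier_simplex (path_ext p a)) _ _ |
     apply: pairK (carrier_simplex (path_ext p c)) _ _] => //; apply: vp; rewrite lexx ac.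
have p0 : path_ext p 0 = vertex b by rewrite path_ext_le0.
have p1 : path_ext p 1 = vertex b by rewrite path_ext_ge1.
have bx t : path_ext p t = vertex b ->
    carrier (vertex b) :|: carrier (path_ext p t) \in K.
  by move=> ->; rewrite finset.setUid carrier_simplex.
have b1 : carrier (path_ext p 1) :|: carrier (vertex b) \in K.
  by rewrite finset.setUC bx.
rewrite (holonomy_edge_class py (bx _ p0) b1).
have seg1 x y' (xy : carrier x :|: carrier y' \in K) : x = y' ->
    transport (segment hK xy) = 1%g.
  move=> xy'; subst y'.
  by rewrite (transport_homotopic _ (segment_cst xy)) transport_cst.
rewrite !seg1// mul1g mulg1 -(transport_base _ spoke_base).
apply: transport_eq => // t; rewrite [RHS]path_extE.
by rewrite -[LHS]/(path_ext p _) subr0 mul1r addr0.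
Qed.

Section CocycleHom.
Variables (G : groupType) (g : T -> T -> G).
Hypothesis gK : forall s, s \in K -> cocycle_on g s.

Definition path_holonomy x y u w (p : {path x ~> y}) : G -> Prop :=
  holonomy g (carrier \o path_ext p) 0 1 u w.

Lemma path_holonomy_inj x y (p : {path x ~> y}) u w z1 z2 :
  path_holonomy u w p z1 -> path_holonomy u w p z2 -> z1 = z2.
Proof. by apply: holonomy_inj => t; exact/gK/carrier_simplex. Qed.

Lemma path_holonomy_cat x y z (p : {path x ~> y}) (q : {path y ~> z}) u v w z1 z2 :
  path_holonomy u v p z1 -> path_holonomy v w q z2 ->
  path_holonomy u w (cat_path p q) (z1 * z2)%g.
Proof.
(* The two holonomies are carried to the halves of the interval by the parameter changes [2 * t] and
   [2 * t - 1]. *)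
move=> pz qz; apply: (@holonomy_cat _ _ _ _ _ _ 2^-1 _ _ v).
- rewrite -[X in holonomy _ _ X](mul0r 2^-1) -[X in (X * _)%R](subrr 0).
  rewrite -[X in holonomy _ _ _ X](mul1r 2^-1) -[X in holonomy _ _ _ (X * _)](subr0 1).
  apply: (holonomy_affine _ pz) => // t t01; rewrite -[LHS]/(carrier (path_ext _ t)).
  by rewrite cat_path_ext ifT ?addr0//; lra.
- have -> : 2^-1 = (0 - -1) / 2 :> R by lra.
  rewrite -[X in holonomy _ _ _ X](_ : (1 - -1) / 2 = 1 :> R); last by lra.
  apply: (holonomy_affine _ qz) => // t t01; rewrite -[LHS]/(carrier (path_ext _ t)).
  (* Only the time 1/2 remains, where [cat_path] reads [p]; the end of [p] is the start of [q]. *)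
  rewrite cat_path_ext; case: ifP => // t2; congr carrier.
  by rewrite (@path_ext_ge1 _ _ _ _ p) ?(@path_ext_le0 _ _ _ _ q)//; lra.
Qed.

(** The first half of the segment lies in the star of [u], the second in the star of [v]; the extra
    factors [g u u] and [g v v] are trivial. *)
Lemma path_holonomy_segment u v (uv : carrier (vertex u) :|: carrier (vertex v) \in K) :
  [set u; v]%SET \in K -> path_holonomy u v (segment hK uv) (g u v).
Proof.
move=> uvK; have [us vs] : u \in [set u; v]%SET /\ v \in [set u; v]%SET.
  by rewrite !inE !eqxx orbT.
have [cu cv] : carrier (vertex u) = [set u]%SET /\ carrier (vertex v) = [set v]%SET.
  by split; apply: carrier_vertex; exact: vertex_simplex uvK _.
have segE t : 0 <= t <= 1 -> path_ext (segment hK uv) t = mix (vertex u) (vertex v) t.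
  by move=> t01; rewrite /path_ext -[LHS]/(mix _ _ (uval _)) uval_clamp.
have su t : 0 <= t <= 2^-1 -> u \in carrier (path_ext (segment hK uv) t).
  move=> t2; rewrite segE; last by lra.
  by apply: (mem_carrier_mixl hK) => //; [lra|rewrite cu inE].
have sv t : 2^-1 <= t <= 1 -> v \in carrier (path_ext (segment hK uv) t).
  move=> t2; rewrite segE; last by lra.
  by apply: (mem_carrier_mixr hK) => //; [lra|rewrite cv inE].
have -> : g u v = ((g u u * g u v) * (g v v * g v v))%g.
  by rewrite !(gK uvK).
have [h0 h1] : 0 <= 2^-1 :> R /\ 2^-1 <= 1 :> R by split; lra.
have u0 : u \in carrier (path_ext (segment hK uv) 0) by rewrite su// lexx.
have vh : v \in carrier (path_ext (segment hK uv) 2^-1) by rewrite sv// lexx.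
have v1 : v \in carrier (path_ext (segment hK uv) 1) by rewrite sv// lexx andbT.
by apply: (@holonomy_cat _ _ _ _ _ _ 2^-1 _ _ v); exact: holonomy_star.
Qed.

(** Holonomy around loops at [b] is homotopy invariant and multiplicative; it is read off edge by
    edge on the loop b, u, v, b. *)
Lemma cocycle_hom :
  exists Phi : {multiplicative fundamental_group R (vertex b) -> G},
  forall u v, [set u; v]%SET \in K ->
    Phi (edge_class u v) = (g b u * g u v * g v b)%g.
Proof.
have bb : b \in carrier (vertex b) by rewrite carrier_vertex// inE.
(* The default 1 is never taken, since every loop has a holonomy. *)
pose Phi (z : fundamental_group R (vertex b)) : G :=
  xget 1%g [set x | path_holonomy b b (repr z) x].
have PhiE (p : {path vertex b ~> vertex b}) x : path_holonomy b b p x ->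
    Phi (loop_class p) = x.
  move=> px; have : path_holonomy b b (repr (loop_class p)) x.
    apply: holonomy_homotopic px => //.
    by apply/loop_classP; rewrite loop_class_repr.
  move=> rx; rewrite /Phi; case: xgetP => [_ _ /path_holonomy_inj/(_ rx) //|].
  by move=> /(_ x).
have PhiM : {morph Phi : y z / (y * z)%g}.
  move=> y z; have [p ->] := loop_class_surj y; have [q ->] := loop_class_surj z.
  have [y' py] := holonomy_exists g p bb bb.
  have [z' qz] := holonomy_exists g q bb bb.
  rewrite loop_classM (PhiE _ _ py) (PhiE _ _ qz).
  exact/PhiE/(path_holonomy_cat py qz).
pose PhiB := isMultiplicative.Build _ _ Phi PhiM.
pose PhiH : {multiplicative fundamental_group R (vertex b) -> G} :=
  HB.pack Phi PhiB.
exists PhiH => u v uvK; rewrite /= -[LHS]/(Phi _).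
have [us vs] : u \in [set u; v]%SET /\ v \in [set u; v]%SET.
  by rewrite !inE !eqxx orbT.
have [uK vK] := (vertex_simplex uvK us, vertex_simplex uvK vs).
have buK := b_cone uK; have vbK : [set v; b]%SET \in K by rewrite finset.setUC b_cone.
have bu := spoke_simplex uK.
have uv : carrier (vertex u) :|: carrier (vertex v) \in K by rewrite !carrier_vertex.
have vb : carrier (vertex v) :|: carrier (vertex b) \in K by rewrite !carrier_vertex.
(* The edges to and from [b] have trivial class, so adding them to the edge from [u] to [v] changes
   nothing. *)
have -> : edge_class u v =
    loop_class (cat_path (cat_path (segment hK bu) (segment hK uv)) (segment hK vb)).
  rewrite -(transport_base _ spoke_base) !transport_cat -!edge_classE.
  have bs : b \in [set v; b]%SET by rewrite !inE eqxx orbT.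
  have vs' : v \in [set v; b]%SET by rewrite !inE eqxx.
  have := edge_class_cocycle vbK bs vs' bs.
  rewrite (cocycle_on_refl (edge_class_cocycle vbK) bs) edge_class_base// mul1g => ->.
  by rewrite edge_class_base// mul1g mulg1.
apply: PhiE; apply: path_holonomy_cat; last exact: path_holonomy_segment.
by apply: path_holonomy_cat; exact: path_holonomy_segment.
Qed.

End CocycleHom.

End EdgeLoops.

(** * Evaluation of words in a group *)

Section Words.
Local Open Scope group_scope.
Context {G : groupType} {n : nat}.
Variable x : 'I_n -> G.

Lemma eval_word_nil : eval_word x [::] = 1.
Proof. by rewrite /eval_word big_nil. Qed.

Lemma eval_word_cons l w :
  eval_word x (l :: w) = (if l.2 then (x l.1)^-1 else x l.1) * eval_word x w.
Proof. by rewrite /eval_word big_cons. Qed.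

Lemma eval_word_cat u v : eval_word x (u ++ v) = eval_word x u * eval_word x v.
Proof. by rewrite /eval_word big_cat. Qed.

Lemma eval_word_inv w : eval_word x (inv_word w) = (eval_word x w)^-1.
Proof.
elim: w => [|l w ih]; first by rewrite eval_word_nil invg1.
rewrite /inv_word /= rev_cons -cats1 eval_word_cat -/(inv_word w) ih.
rewrite !eval_word_cons eval_word_nil mulg1 invgM; congr (_ * _).
by case: l => i [] /=; rewrite ?invgK.
Qed.

Lemma eval_word_free_eq u v : free_eq u v -> eval_word x u = eval_word x v.
Proof.
elim=> [{}u {}v i e|//|{}u {}v _ -> //|{}u {}v w _ -> _ -> //].
rewrite !eval_word_cat !eval_word_cons /=; congr (_ * _).
by case: e => /=; rewrite ?mulVg ?mulgV ?mulKg ?mulVKg.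
Qed.

Lemma eval_word_normal_closure rels w :
  (forall r, r \in rels -> eval_word x r = 1) ->
  normal_closure rels w -> eval_word x w = 1.
Proof.
move=> xr; elim=> [r /xr//||u v _ u1 _ v1|u _ u1|u v _ u1|u v uv _ u1].
- exact: eval_word_nil.
- by rewrite eval_word_cat u1 v1 mulg1.
- by rewrite eval_word_inv u1 invg1.
- by rewrite !eval_word_cat u1 mul1g eval_word_inv mulgV.
- by rewrite -(eval_word_free_eq uv).
Qed.

End Words.

(** * Recognizing a presented group *)

Section Presentation.
Local Open Scope group_scope.
Context {G H : groupType}.

Lemma eval_word_morph n (x : 'I_n -> H) (Phi : {multiplicative H -> G}) w :
  Phi (eval_word x w) = eval_word (Phi \o x) w.
Proof.
have Phi1 : Phi 1 = 1 by apply: (mulgI (Phi 1)); rewrite -gmulfM !mulg1.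
have PhiV y : Phi y^-1 = (Phi y)^-1.
  by apply: (mulgI (Phi y)); rewrite -gmulfM !mulgV.
elim: w => [|[i []] w ih]; first by rewrite !eval_word_nil.
  by rewrite !eval_word_cons gmulfM ih /= PhiV.
by rewrite !eval_word_cons gmulfM ih.
Qed.

(** The inverse evaluates at [x] any word representing the given element of [G]. Two such words
    differ by an element of the normal closure, which evaluates to 1 at [x]. *)
Lemma presentation_bij n (gen : 'I_n -> G) rels (x : 'I_n -> H)
    (Phi : {multiplicative H -> G}) :
  is_presentation gen rels -> (forall i, Phi (x i) = gen i) ->
  (forall y, exists w, y = eval_word x w) ->
  (forall r, r \in rels -> eval_word x r = 1) -> bijective Phi.
Proof.
move=> [gen_surj gen_rels] Phix x_surj x_rels.
have PhiE w : Phi (eval_word x w) = eval_word gen w.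
  by rewrite eval_word_morph; congr eval_word; apply/funext => i; exact: Phix.
have surj z : exists w, eval_word gen w == z.
  by have [w <-] := gen_surj z; exists w.
exists (fun z => eval_word x (xchoose (surj z))) => z; last first.
  by rewrite PhiE; exact/eqP/(xchooseP (surj z)).
have [w zE] := x_surj z; set w' := xchoose _.
have w'E : eval_word gen w' = eval_word gen w.
  by rewrite -(PhiE w) -zE; exact/eqP/(xchooseP (surj (Phi z))).
rewrite zE; have : normal_closure rels (w' ++ inv_word w).
  by apply/gen_rels; rewrite eval_word_cat eval_word_inv w'E mulgV.
move=> /(eval_word_normal_closure x_rels); rewrite eval_word_cat eval_word_inv.
by move/(congr1 (fun y => y * eval_word x w)); rewrite mulgVK mul1g.
Qed.

Lemma group_isomorphic_trans (M : groupType) :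
  group_isomorphic G H -> group_isomorphic H M -> group_isomorphic G M.
Proof.
move=> [f f_bij] [h h_bij]; pose hf : {multiplicative G -> M} := h \o f.
by exists hf; exact: bij_comp.
Qed.

End Presentation.

(** * The complex on which a labelling is a coboundary *)

Section LabelledGraph.
Local Open Scope group_scope.
Context {G : groupType} {V : finType}.
Variable label : V -> V -> G.
Hypothesis label_refl : forall u, label u u = 1.
Hypothesis label_sym : forall u v, label v u = (label u v)^-1.

(* The four extra elements are not vertices of the complex. *)
Definition padded : finType := (V + 'I_4)%type.

Definition padded_label (u v : padded) : G :=
  if (u, v) is (inl u, inl v) then label u v else 1.

(** The function [h] is a potential with coboundary the labelling; it restricts to subsets, so
    flatness is hereditary. *)
Definition flat (s : {set padded}) : Prop :=
  (forall u, u \in s -> exists v, u = inl v) /\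
  exists h, forall u v, u \in s -> v \in s -> padded_label u v = (h u)^-1 * h v.

Definition flat_complex : {set {set padded}} := [set s | `[< flat s >]].

Lemma flat_complexP s : reflect (flat s) (s \in flat_complex).
Proof. by rewrite inE; exact: asboolP. Qed.

Lemma flat_complex_simplicial : simplicial_complex flat_complex.
Proof.
split=> [|s t /flat_complexP[sV [h hs]] /fintype.subsetP ts].
  by apply/flat_complexP; split=> [u|]; [|exists (fun=> 1) => u v]; rewrite inE.
apply/flat_complexP; split=> [u /ts/sV//|].
by exists h => u v /ts us /ts vs; exact: hs.
Qed.

Lemma flat_complex_cocycle s : s \in flat_complex -> cocycle_on padded_label s.
Proof.
move=> /flat_complexP[_ [h hs]] u v w us vs ws.
by rewrite !hs// mulgA mulgK.
Qed.

Lemma flat_complex_vertexP u :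
  reflect (exists v, u = inl v) ([set u] \in flat_complex).
Proof.
apply: (iffP (flat_complexP _)) => [[uV _]|[v ->]].
  by apply: uV; rewrite inE.
split=> [w|]; first by rewrite inE => /eqP ->; exists v.
exists (fun=> 1) => a c; rewrite !inE => /eqP -> /eqP ->.
by rewrite mulVg /padded_label label_refl.
Qed.

(** The labels read from [u] serve as potential. *)
Lemma flat_triangle u v w : label u v * label v w = label u w ->
  [set inl u; inl v; inl w] \in flat_complex.
Proof.
move=> uvw; apply/flat_complexP; split=> [a|].
  by rewrite !inE => /orP[/orP[]|] /eqP ->; eexists.
exists (padded_label (inl u)) => a c.
rewrite !inE => /orP[/orP[]|] /eqP -> /orP[/orP[]|] /eqP -> /=;
  rewrite /padded_label ?label_refl ?invg1 ?mul1g ?mulg1 ?mulVg// -?label_sym//.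
- by rewrite (label_sym u v) -uvw mulKg.
- by rewrite (label_sym u w) -uvw invgM mulgVK (label_sym v w).
Qed.

Lemma flat_edge u v : [set inl u; inl v] \in flat_complex.
Proof.
have := @flat_triangle u v v; rewrite label_refl mulg1 => /(_ erefl).
by rewrite -finset.setUA finset.setUid.
Qed.

End LabelledGraph.

(** * The labelled graph of a presentation *)

Section PresentationGraph.
Local Open Scope group_scope.
Context {G : groupType} {n : nat}.
Variables (gen : 'I_n -> G) (rels : seq (word n)).
Hypothesis pres : is_presentation gen rels.

(** A common bound lets all relators share one index type; past the end of a relator its prefix
    stays constant. *)
Definition max_size : nat := \max_(r <- rels) size r.

(** [None] is the base point, the left summand holds the ends of the generator edges, the right one
    the ends of the letters of the relators. *)
Definition node : finType :=
  option (('I_n * bool) + ('I_(size rels) * 'I_max_size.+1 * bool)).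

Definition hub (i : 'I_n) (c : bool) : node := Some (inl (i, c)).
(* [pos k j false] and [pos k j true] are the ends of the [j]-th letter of the
   [k]-th relator; [pos k j true] and [pos k j.+1 false] are joined by an edge
   labelled 1. With a single vertex for both, two equal consecutive letters
   would put two labels on one edge to a hub. *)
Definition pos k (j : 'I_max_size.+1) (c : bool) : node := Some (inr (k, j, c)).

Definition rel_at (k : 'I_(size rels)) : word n := nth [::] rels k.

Definition gen_pow (i : 'I_n) (c : bool) : G := if c then gen i else 1.

(** The boolean counts as 0 or 1, so the end of a letter and the start of the next one get the same
    prefix. *)
Definition prefix_value k (j : 'I_max_size.+1) (c : bool) : G :=
  eval_word gen (take (j + c) (rel_at k)).

(* A letter [(i, e)] runs from [hub i e] to [hub i (~~ e)]. *)
Definition hub_pos_label i (c : bool) k (j : 'I_max_size.+1) (d : bool) : G :=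
  if drop j (rel_at k) is (i', e) :: _ then
    if i' == i then (gen_pow i c)^-1 * gen_pow i (d (+) e) else 1
  else 1.

Definition node_label (u v : node) : G :=
  match u, v with
  | Some (inl (i, c)), Some (inl (i', c')) =>
    if i == i' then (gen_pow i c)^-1 * gen_pow i c' else 1
  | Some (inr (k, j, c)), Some (inr (k', j', c')) =>
    if k == k' then (prefix_value k j c)^-1 * prefix_value k j' c' else 1
  | Some (inl (i, c)), Some (inr (k, j, d)) => hub_pos_label i c k j d
  | Some (inr (k, j, d)), Some (inl (i, c)) => (hub_pos_label i c k j d)^-1
  | _, _ => 1
  end.

Lemma node_label_refl u : node_label u u = 1.
Proof.
by case: u => [[[i c]|[[k j] c]]|] //=; rewrite eqxx mulVg.
Qed.

Lemma node_label_sym u v : node_label v u = (node_label u v)^-1.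
Proof.
case: u v => [[[i c]|[[k j] c]]|] [[[i' c']|[[k' j'] c']]|] //=;
  rewrite ?invg1 ?invgK//.
  by rewrite eq_sym; case: eqP => [->|_]; rewrite ?invg1// invgM invgK.
by rewrite eq_sym; case: eqP => [->|_]; rewrite ?invg1// invgM invgK.
Qed.

(** * Relations forced on every cocycle that is trivial at the base point *)

Section UniversalCocycle.
Variables (H : groupType) (F : node -> node -> H).
Hypothesis F_triangle : forall u v w,
  node_label u v * node_label v w = node_label u w -> F u v * F v w = F u w.
Hypothesis F_base : forall v, F None v = 1.

Definition loop_at (i : 'I_n) : H := F (hub i false) (hub i true).

(** The pair forms a triangle with the base point, and [F] is trivial on the two other sides. *)
Lemma label1_trivial u v : node_label u v = 1 -> F u v = 1.
Proof.
move=> uv1; rewrite -(F_base v) -(@F_triangle None u v) ?uv1 ?mul1g//.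
by rewrite F_base mul1g.
Qed.

Lemma F_inv u v : F v u = (F u v)^-1.
Proof.
apply: (mulgI (F u v)); rewrite mulgV F_triangle.
  by rewrite label1_trivial ?node_label_refl.
by rewrite node_label_refl (node_label_sym u v) mulgV.
Qed.

Definition letter (l : 'I_n * bool) : H :=
  if l.2 then (loop_at l.1)^-1 else loop_at l.1.

Lemma F_hub i (e : bool) : F (hub i e) (hub i (~~ e)) = letter (i, e).
Proof. by case: e => //; rewrite F_inv. Qed.

(** The edge of a letter is compared with its generator edge by two triangles; the ties from its
    ends to the matching hubs are labelled 1. Beyond the relator the edge itself is labelled 1. *)
Lemma F_step k j : F (pos k j false) (pos k j true) =
  eval_word loop_at (take 1 (drop j (rel_at k))).
Proof.
have labelE : node_label (pos k j false) (pos k j true) =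
    eval_word gen (take 1 (drop j (rel_at k))).
  rewrite /= eqxx /prefix_value addn0 takeD eval_word_cat mulKg//.
case E : (drop j (rel_at k)) labelE => [|[i e] w] labelE /=.
  by rewrite eval_word_nil label1_trivial// labelE eval_word_nil.
rewrite take0 eval_word_cons eval_word_nil mulg1 -[RHS]/(letter (i, e)) -F_hub.
have h0 : node_label (pos k j false) (hub i e) = 1.
  by rewrite /= /hub_pos_label E eqxx addFb mulVg invg1.
have h1 : node_label (hub i (~~ e)) (pos k j true) = 1.
  by rewrite /= /hub_pos_label E eqxx addTb mulVg.
have hE : node_label (pos k j false) (hub i (~~ e)) =
    node_label (hub i e) (hub i (~~ e)).
  by rewrite /= /hub_pos_label E !eqxx addFb invgM invgK.
rewrite -(@F_triangle (pos k j false) (hub i (~~ e)) (pos k j true)).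
  rewrite (label1_trivial h1) mulg1.
  rewrite -(@F_triangle (pos k j false) (hub i e) (hub i (~~ e))).
    by rewrite (label1_trivial h0) mul1g.
  by rewrite h0 mul1g hE.
rewrite h1 mulg1 hE labelE /= take0 eval_word_cons eval_word_nil mulg1 eqxx.
by case: (e) => /=; rewrite /gen_pow ?mulg1 ?invg1 ?mul1g.
Qed.

(** The prefix values are a potential for all positions of one relator. *)
Lemma F_pos k j c j' c' j'' c'' :
  F (pos k j c) (pos k j' c') * F (pos k j' c') (pos k j'' c'') =
  F (pos k j c) (pos k j'' c'').
Proof. by apply: F_triangle; rewrite /= eqxx mulgA mulgK. Qed.

(** Induction along the relator, alternating letter edges with connecting edges labelled 1. *)
Lemma F_prefix k (j : 'I_max_size.+1) (c : bool) :
  F (pos k ord0 false) (pos k j c) = eval_word loop_at (take (j + c) (rel_at k)).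
Proof.
have stepT j' : F (pos k ord0 false) (pos k j' false) =
      eval_word loop_at (take j' (rel_at k)) ->
    F (pos k ord0 false) (pos k j' true) =
      eval_word loop_at (take j'.+1 (rel_at k)).
  move=> j'E; rewrite -(F_pos _ _ _ j' false) j'E F_step.
  by rewrite -eval_word_cat -takeD addn1.
suff j0 : F (pos k ord0 false) (pos k j false) =
    eval_word loop_at (take j (rel_at k)).
  by case: c; rewrite ?addn0 ?addn1//; exact: stepT.
case: j => j; elim: j => [|j ih] jM /=.
  rewrite take0 eval_word_nil label1_trivial//=.
  by rewrite eqxx /prefix_value /= addn0 take0 eval_word_nil mulVg.
have := stepT (Ordinal (ltnW jM)) (ih (ltnW jM)) => /= <-.
rewrite -(F_pos _ _ _ (Ordinal (ltnW jM)) true) [X in _ * X]label1_trivial ?mulg1//.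
by rewrite /= eqxx /prefix_value /= addn0 addn1 mulVg.
Qed.

(** The edge from the first position to the last is labelled by the value of [r] in [G], which is 1,
    while [F] on it is the value of [r] at the loops. *)
Lemma eval_rel r : r \in rels -> eval_word loop_at r = 1.
Proof.
move=> r_rels; have kP : (index r rels < size rels)%N by rewrite index_mem.
pose k := Ordinal kP; have kE : rel_at k = r by rewrite /rel_at nth_index.
have takeM : take (@ord_max max_size + false) (rel_at k) = r.
  rewrite kE addn0 take_oversize// /max_size /=.
  exact: (leq_bigmax_seq (F := size)).
rewrite -[in LHS]takeM -F_prefix label1_trivial//=.
rewrite eqxx /prefix_value takeM take0 eval_word_nil invg1 mul1g.
exact/pres.2/normal_closure_rel.
Qed.

Definition is_value (y : H) : Prop := exists w, y = eval_word loop_at w.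

Lemma is_value1 : is_value 1.
Proof. by exists [::]; rewrite eval_word_nil. Qed.

Lemma is_valueM y z : is_value y -> is_value z -> is_value (y * z).
Proof. by move=> [u ->] [v ->]; exists (u ++ v); rewrite eval_word_cat. Qed.

Lemma is_valueV y : is_value y -> is_value y^-1.
Proof. by move=> [w ->]; exists (inv_word w); rewrite eval_word_inv. Qed.

(** An edge from a hub to a position of its generator passes through the hub tied to that position,
    and an edge between positions of one relator through the first position. Edges between unrelated
    nodes are labelled 1. *)
Lemma is_value_F u v : is_value (F u v).
Proof.
have hubP i c d : is_value (F (hub i c) (hub i d)).
  have [<-|/eqP] := eqVneq c d.
    by rewrite label1_trivial ?node_label_refl//; exact: is_value1.
  move=> cd; have -> : d = ~~ c by case: c d cd => [] [].
  by exists [:: (i, c)]; rewrite F_hub eval_word_cons eval_word_nil mulg1.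
have hub_posP i c k j d : is_value (F (hub i c) (pos k j d)).
  case E : (drop j (rel_at k)) => [|[i' e] w].
    by rewrite label1_trivial; [exact: is_value1|rewrite /= /hub_pos_label E].
  have [i'E|i'i] := eqVneq i' i; last first.
    rewrite label1_trivial; first exact: is_value1.
    by rewrite /= /hub_pos_label E (negbTE i'i).
  have h1 : node_label (hub i (d (+) e)) (pos k j d) = 1.
    by rewrite /= /hub_pos_label E i'E eqxx mulVg.
  rewrite -(@F_triangle _ (hub i (d (+) e))).
    by rewrite (label1_trivial h1) mulg1.
  by rewrite h1 /= /hub_pos_label E i'E !eqxx mulg1.
case: u v => [[[i c]|[[k j] c]]|] [[[i' c']|[[k' j'] c']]|];
  rewrite -/(hub _ _) -?/(hub _ _) -?/(pos _ _ _).
- have [<-|ii'] := eqVneq i i'; first exact: hubP.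
  by rewrite label1_trivial; [exact: is_value1|rewrite /= (negbTE ii')].
- exact: hub_posP.
- by rewrite label1_trivial//; exact: is_value1.
- by rewrite F_inv; apply: is_valueV; exact: hub_posP.
- have [<-|kk'] := eqVneq k k'; last first.
    by rewrite label1_trivial; [exact: is_value1|rewrite /= (negbTE kk')].
  rewrite -(F_pos _ _ _ ord0 false) F_inv !F_prefix.
  by apply: is_valueM; [apply: is_valueV|]; eexists.
- by rewrite label1_trivial//; exact: is_value1.
- by rewrite F_base; exact: is_value1.
- by rewrite F_base; exact: is_value1.
- by rewrite F_base; exact: is_value1.
Qed.

End UniversalCocycle.

End PresentationGraph.

(** * Simple connectivity from triangles at [b], and independence of the base point *)

Section FundamentalGroups.
Local Open Scope group_scope.
Context {R : realType} {T : finType} {K : {set {set T}}}.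
Hypothesis hK : simplicial_complex K.

(** Each edge forms a triangle with [b], which makes its class trivial, and these classes
    generate. *)
Lemma cone_simply_connected b : [set b] \in K ->
  (forall u v, [set u; v] \in K -> [set b; u; v] \in K) ->
  simply_connected R (realization R K).
Proof.
move=> bK bT; have b_cone v : [set v] \in K -> [set b; v] \in K.
  by rewrite -[[set v]]finset.setUid => /bT; rewrite -finset.setUA finset.setUid.
have [x0] := @realization_inhabited R T K b bK.
split; first by refine (realization_path_connected hK x0 bK b_cone).
have triv (z : fundamental_group R (vertex x0 b)) : z = 1.
  move: z; apply: (@edge_class_generate R T K hK x0 b bK b_cone (fun z => z = 1));
    last by move=> y z -> ->; exact: mulg1.
  move=> u v uvK.
  have buvK := bT _ _ uvK.
  have [bs us vs] : [/\ b \in [set b; u; v], u \in [set b; u; v] & v \in [set b; u; v]].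
    by rewrite !inE !eqxx !orbT.
  have := edge_class_cocycle hK x0 bK b_cone buvK bs us vs.
  by rewrite !edge_class_base ?mul1g//; apply: (vertex_simplex hK buvK).
move=> x z; apply: (bij_inj (base_change_bij (spoke hK x0 bK b_cone) x)).
exact: etrans (triv _) (esym (triv _)).
Qed.

Lemma has_fundamental_group_base (G : groupType) b (x0 : realization R K)
    (bK : [set b] \in K) (b_cone : forall v, [set v] \in K -> [set b; v] \in K) :
  group_isomorphic (fundamental_group R (vertex x0 b)) G ->
  has_fundamental_group R (realization R K) G.
Proof.
move=> bG; split; first by refine (realization_path_connected hK x0 bK b_cone).
move=> x; apply: group_isomorphic_trans bG.
exists (@base_change R _ _ (spoke hK x0 bK b_cone) x).
exact: base_change_bij.
Qed.

End FundamentalGroups.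

(** * The fundamental group of the complex of a presentation *)

Section FlatFundamentalGroup.
Local Open Scope group_scope.
Context {R : realType} {G : groupType} {n : nat}.
Variables (gen : 'I_n -> G) (rels : seq (word n)).
Hypothesis pres : is_presentation gen rels.
Local Notation label := (node_label gen (rels := rels)).
Local Notation L := (flat_complex label).
Local Notation base := (inl None : @padded (node rels)).

Let label_refl := @node_label_refl G n gen rels.
Let label_sym := @node_label_sym G n gen rels.

Lemma flat_base : [set base] \in L.
Proof. by apply/(flat_complex_vertexP label_refl); eexists. Qed.

Lemma flat_cone u : [set u] \in L -> [set base; u] \in L.
Proof.
move=> /(flat_complex_vertexP label_refl)[v ->].
exact: flat_edge label_refl label_sym _ _.
Qed.

(** Holonomy of the labelling sends the loop of each generator to that generator. The edge classes
    form a cocycle [F] as above, so these loops generate and satisfy the relators. *)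
Lemma flat_has_fundamental_group : has_fundamental_group R (realization R L) G.
Proof.
have hL := flat_complex_simplicial label.
have [x0] := @realization_inhabited R _ _ _ flat_base.
apply: (has_fundamental_group_base hL flat_base flat_cone (x0 := x0)).
pose F (u v : node rels) := edge_class hL x0 flat_base flat_cone (inl u) (inl v).
have F_triangle u v w : label u v * label v w = label u w -> F u v * F v w = F u w.
  move=> /(flat_triangle label_refl label_sym) uvw.
  by apply: (edge_class_cocycle _ _ _ _ uvw); rewrite !inE eqxx ?orbT.
have F_base v : F None v = 1.
  apply: edge_class_base; apply/(flat_complex_vertexP label_refl); by eexists.
have [Phi PhiE] := cocycle_hom hL x0 flat_base flat_cone (@flat_complex_cocycle _ _ label).
exists Phi; apply: (presentation_bij pres (x := loop_at F)).
- move=> i; rewrite PhiE.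
    by rewrite /padded_label /node_label /= eqxx /gen_pow invg1 !mul1g mulg1.
  exact: flat_edge.
- apply: (@edge_class_generate R _ L hL x0 base flat_base flat_cone) => [u v uvL|y z].
    have [u' uE] : exists u', u = inl u'.
      by apply/(flat_complex_vertexP label_refl)/(vertex_simplex hL uvL); rewrite !inE eqxx.
    have [v' vE] : exists v', v = inl v'.
      by apply/(flat_complex_vertexP label_refl)/(vertex_simplex hL uvL); rewrite !inE eqxx orbT.
    rewrite {}uE {}vE; exact: is_value_F F_triangle F_base _ _.
  exact: is_valueM.
- exact: eval_rel F_triangle F_base.
Qed.

End FlatFundamentalGroup.

(** * Faces of the Alexander dual *)

Section Dual.
Context {V : finType} {G : groupType} (label : V -> V -> G).
Local Notation L := (flat_complex label).
Local Notation T := (@padded V).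

Lemma alexander_dual_setTK (S : finType) (K : {set {set S}}) :
  alexander_dual [set: S] (alexander_dual [set: S] K) = K.
Proof.
by apply/setP => s; rewrite !inE !finset.subsetT !finset.setTD finset.setCK negbK.
Qed.

Lemma flat_complex_pad (s : {set T}) i : inr i \in s -> s \notin L.
Proof. by move=> si; apply/negP => /flat_complexP[sV _]; have [] := sV _ si. Qed.

Lemma setT_notin_flat : [set: T] \notin L.
Proof. by apply: (@flat_complex_pad _ ord0); rewrite inE. Qed.

(** One of the four extra elements is missing from [s], so it lies in the complement, which is then
    not a face of [L]. *)
Lemma dual_flat_small (s : {set T}) : (#|s| <= 3)%N -> s \in alexander_dual [set: T] L.
Proof.
move=> s3; rewrite inE finset.subsetT finset.setTD /=.
have [i si] : exists i : 'I_4, inr i \notin s.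
  apply/existsP; apply: contraLR s3 => /existsPn allin; rewrite -ltnNge.
  have sub : [set (inr i : T) | i : 'I_4] \subset s.
    by apply/fintype.subsetP => _ /imsetP[i _ ->]; have := allin i; rewrite negbK.
  apply: leq_trans (subset_leq_card sub).
  by rewrite card_imset ?card_ord//; exact: inr_inj.
by apply: (@flat_complex_pad _ i); rewrite inE.
Qed.

End Dual.

Theorem corollary2p2 (R : realType) (G : groupType)
    (hG : finitely_presented G) :
  exists (T : finType) (K : {set {set T}}) (V : {set T}),
    [/\ simplicial_complex K,
        vertices K \subset V,
        simply_connected R (realization R K) &
        has_fundamental_group R (realization R (alexander_dual V K)) G].
Proof.
have [n [gen [rels pres]]] := hG.
pose L := flat_complex (node_label gen (rels := rels)).
have hK : simplicial_complex (alexander_dual [set: @padded (node rels)] L).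
  exact: alexander_dual_complex (flat_complex_simplicial _) (setT_notin_flat _).
exists (@padded (node rels)), (alexander_dual finset.setT L), finset.setT; split => //.
(* The sets to be checked have at most three elements, hence are faces of the dual. *)
- apply: (cone_simply_connected hK (b := inl None)) => [|u v _].
    by apply: dual_flat_small; rewrite cards1.
  apply: dual_flat_small; apply: leq_trans (leq_card_setU _ _).1 _.
  by rewrite cards1 addn1 ltnS (leq_trans (leq_card_setU _ _).1)// !cards1.
- by rewrite alexander_dual_setTK; exact: flat_has_fundamental_group.
Qed.
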